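(* Let $n\ge2$, $1\le k\le n-1$, $\alpha_1,\alpha_2\in\mathbb{R}$, and suppose either $\alpha_1+\alpha_2>k-n$ and $1\le p=\frac{\alpha_1+n}{k}<\frac{\alpha_1+\alpha_2+n-1}{k-1}$ (the right-hand side read as $+\infty$ if $k=1$), or $\alpha_1+\alpha_2=k-n$ and $\frac{\alpha_1+n}{k}=p=1$. Let $\gamma\in\mathbb{R}$ and consider $$\|\cosh^\gamma d(0,\cdot)\,R_kf\|_{L^\infty(\Xi_k(\mathbb{H}^n))}\le C\|f\|_{L^{p,1}_{\alpha_1,\alpha_2}(\mathbb{H}^n)}\quad\text{for all radial }f\in L^{p,1}_{\alpha_1,\alpha_2}(\mathbb{H}^n).\qquad( * )$$ (A) If $k\ge2$, $( * )$ holds if and only if $\gamma\le\frac{\alpha_1+\alpha_2+n-1}{p}$. (B) If $k=1$, $( * )$ holds if and only if $\gamma\le\frac{\alpha_1+\alpha_2+n-1}{p}$ and $p\ge2$.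
   Context: $\mathbb{H}^n$ real hyperbolic space of curvature $-1$ (Poincaré ball model), origin $0$, distance $d$, volume $dx$. $\Xi_k(\mathbb{H}^n)$: $k$-dimensional totally geodesic submanifolds, $d(0,\xi)=\inf_{x\in\xi}d(0,x)$, with isometry-invariant measure ($L^\infty$ = essential supremum). $R_kf(\xi)=\int_\xi f\,d_\xi x$. $L^{p,1}_{\alpha_1,\alpha_2}(\mathbb{H}^n)$ is the Lorentz space $L^{p,1}(\mathbb{H}^n,\mu)$ for the measure $d\mu=\sinh^{\alpha_1}d(0,x)\cosh^{\alpha_2}d(0,x)dx$, with norm $\|f\|_{L^{p,1}}=p\int_0^\infty\mu(\{|f|>s\})^{1/p}ds$. Radial means depending only on $d(0,x)$. $C$ independent of $f$. *)

(* Defs.v *)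
(* Real hyperbolic space H^n is modelled by the
   hyperboloid (upper sheet) in Minkowski space R^{n+1}. *)
From HB Require Import structures.
From mathcomp Require Import all_boot all_order all_algebra.
From mathcomp Require Import all_classical all_reals.
From mathcomp Require Import topology normedtype sequences exp measure
  lebesgue_measure lebesgue_integral numfun.
Set Implicit Arguments.
Unset Strict Implicit.
Unset Printing Implicit Defensive.
Import Order.TTheory GRing.Theory Num.Theory.
Local Open Scope classical_set_scope.
Local Open Scope ring_scope.

Section Hyperbolic.
Variable R : realType.

Definition sqnorm m (v : 'I_m -> R) : R := \sum_(i < m) v i ^+ 2.

Definition mink m (x y : 'I_m.+1 -> R) : R :=
  - (x ord0 * y ord0) + \sum_(i < m.+1 | i != ord0) x i * y i.

Definition Hyp m : set ('I_m.+1 -> R) :=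
  [set x | mink x x = -1 /\ 0 < x ord0].

Definition coshR (t : R) : R := (expR t + expR (- t)) / 2.
Definition sinhR (t : R) : R := (expR t - expR (- t)) / 2.
Definition acoshR (t : R) : R := ln (t + Num.sqrt (t ^+ 2 - 1)).

(** hyperbolic distance from the origin o = (1,0,...,0):  d(o,x) = arccosh(x_0) *)
Definition dist0 m (x : 'I_m.+1 -> R) : R := acoshR (x ord0).

Definition dist0_set m (xi : set ('I_m.+1 -> R)) : R := inf (@dist0 m @` xi).

(** global chart R^m -> H^m, v |-> (sqrt(1+|v|^2), v);
    Riemannian volume in this chart is dv / sqrt(1+|v|^2) *)
Definition chart m (v : 'I_m -> R) : 'I_m.+1 -> R :=
  fun i => match unlift ord0 i with
           | Some j => v j
           | None => Num.sqrt (1 + sqnorm v)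
           end.

Definition vol_density m (v : 'I_m -> R) : R := (Num.sqrt (1 + sqnorm v))^-1.

Definition cons_pt m (x : R) (v : 'I_m -> R) : 'I_m.+1 -> R :=
  fun i => match unlift ord0 i with Some j => v j | None => x end.

(** iterated Lebesgue integral over R^m (= integral w.r.t. m-dimensional
    Lebesgue measure for Borel integrands, by Fubini--Tonelli) *)
Fixpoint iint (m : nat) : (('I_m -> R) -> \bar R) -> \bar R :=
  match m with
  | 0 => fun F => F (fun _ => 0)
  | m'.+1 => fun F =>
      (\int[@lebesgue_measure R]_x iint (fun v => F (cons_pt x v)))%E
  end.

Definition boxes m : set (set ('I_m -> R)) :=
  [set B | exists a b : 'I_m -> R, B = [set x | forall i, a i < x i < b i]].

Definition borel m (N : set ('I_m -> R)) : Prop := <<s @boxes m >> N.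

Definition negligible m (B : set ('I_m -> R)) : Prop :=
  exists N, borel N /\ B `<=` N /\ iint (fun x => (\1_N x)%:E) = 0%E.

Definition mu_w n (a1 a2 : R) (A : set ('I_n.+1 -> R)) : \bar R :=
  iint (fun v : 'I_n -> R =>
    (\1_A (chart v) * (sinhR (dist0 (chart v))) `^ a1
       * (coshR (dist0 (chart v))) `^ a2 * vol_density v)%:E).

Definition lorentz_norm n (a1 a2 p : R) (f : ('I_n.+1 -> R) -> R) : \bar R :=
  (p%:E * \int[@lebesgue_measure R]_(s in `[0%R, +oo[%classic)
      poweR (mu_w a1 a2 [set x | @Hyp n x /\ ((s : R) < `|f x|)%R]) (p^-1))%E.

Definition radial n (f : ('I_n.+1 -> R) -> R) : Prop :=
  exists f0 : R -> R, measurable_fun setT f0 /\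
    forall x, @Hyp n x -> f x = f0 (dist0 x).

Definition in_Lp1 n (a1 a2 p : R) (f : ('I_n.+1 -> R) -> R) : Prop :=
  (lorentz_norm a1 a2 p f < +oo)%E.

Definition lapp n k (L : 'I_n.+1 -> 'I_k.+1 -> R) (y : 'I_k.+1 -> R) :
  'I_n.+1 -> R := fun i => \sum_j L i j * y j.

(** isometric totally geodesic embeddings H^k -> H^n: linear maps preserving
    the Minkowski form and mapping the upper sheet into the upper sheet *)
Definition hyp_embedding n k (L : 'I_n.+1 -> 'I_k.+1 -> R) : Prop :=
  (forall y z, mink (lapp L y) (lapp L z) = mink y z) /\
  (forall y, @Hyp k y -> @Hyp n (lapp L y)).

(** Radon transform over xi = L(H^k): int_xi f, computed in the chart of H^k *)
Definition radon n k (L : 'I_n.+1 -> 'I_k.+1 -> R)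
    (f : ('I_n.+1 -> R) -> R) : \bar R :=
  iint (fun y : 'I_k -> R => (f (lapp L (chart y)) * vol_density y)%:E).

(** parametrisation of Xi_k(H^n): a matrix z in R^{(n+1)(k+1)} with linearly
    independent columns whose span meets H^n gives xi = H^n ∩ colspan *)
Definition mx_of n k (z : 'I_(n.+1 * k.+1) -> R) : 'I_n.+1 -> 'I_k.+1 -> R :=
  fun i j => z (mxvec_index i j).

Definition xi_of n k (z : 'I_(n.+1 * k.+1) -> R) : set ('I_n.+1 -> R) :=
  [set x | @Hyp n x /\ exists c, x = lapp (mx_of z) c].

Definition valid_param n k (z : 'I_(n.+1 * k.+1) -> R) : Prop :=
  (forall c, lapp (mx_of z) c = (fun _ => 0) -> c = (fun _ => 0)) /\
  xi_of z !=set0.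

(** ( * ):  || cosh^gamma d(0,.) R_k f ||_{L^oo(Xi_k)} <= C ||f||_{L^{p,1}}
    for all radial f in L^{p,1}, the L^oo taken w.r.t. the (class of the)
    invariant measure on Xi_k *)
Definition radon_estimate n k (a1 a2 p gamma : R) : Prop :=
  exists C : R, forall f : ('I_n.+1 -> R) -> R,
    radial f -> in_Lp1 a1 a2 p f ->
    negligible [set z : 'I_(n.+1 * k.+1) -> R | valid_param z /\
      exists L, hyp_embedding L /\ lapp L @` @Hyp k = xi_of z /\
        (C%:E * lorentz_norm a1 a2 p f <
         ((coshR (dist0_set (xi_of z))) `^ gamma)%:E * `|radon L f|)%E].

End Hyperbolic.

(* Main.v *)
Require Import Defs.
From HB Require Import structures.
From mathcomp Require Import all_boot all_order all_algebra.
From mathcomp Require Import all_classical all_reals.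
From mathcomp Require Import topology normedtype sequences exp measure
  lebesgue_measure lebesgue_integral numfun.
From mathcomp Require Import ereal derive realfun measurable_realfun ftc charge.
From mathcomp Require Import ring lra.
Set Implicit Arguments.
Unset Strict Implicit.
Unset Printing Implicit Defensive.
Import Order.TTheory GRing.Theory Num.Theory.
Import numFieldNormedType.Exports.
Local Open Scope classical_set_scope.
Local Open Scope ring_scope.

(** Write [t = sinh^2 d(0,x)], [f x = F (sqrt (1 + t))], [q = (a1 + n) / 2 = p k / 2]
    and [A = cosh d(0,xi)].  A Lorentz boost, performed one variable at a time,
    makes the height of a point of [xi] equal to [A] times its height in the
    model [H^k], so that polar coordinates give, up to constants,
    [R_k f xi = int F (A sqrt (1+t)) (1+t)^(-1/2) t^(k/2-1) dt] and
    [mu {|f| > s} = int_{|F| > s} t^(q-1) (1+t)^((a2-1)/2) dt].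

    Sufficiency.  By the layer-cake formula it is enough to treat indicators of
    Borel sets [E].  Since [q >= 1], the change of variables
    [t |-> A^2 (1+t) - 1 >= A^2 t] scales both sides by the same power of [A] when
    [gamma = (a1+a2+n-1)/p] and reduces the matter to [A = 1].  There, with
    [nu = (1+t)^(-1/2) t^(k/2-1) dt] and [phi = t^(k/2) (1+t)^(a2/(2(p-1)))], the
    weak-type bound [nu {phi < l} <= K l] gives
    [nu E <= K l + l^(1-p) int_E phi^(p-1) dnu] for all [l > 0]; optimise in [l].

    Necessity.  For the indicator of [X < cosh^2 d < X + 2h], [h = r X], the planes
    with [X < A^2 < X + h] give [X^(gamma/2) r^(k/2) <= C X^(gamma'/2) r^(1/p)],
    [gamma' = (a1+a2+n-1)/p].  Let [X] tend to infinity with [r = 1], or [r] to [0]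
    with [X = 4].  These planes form a non-negligible set because Gram-Schmidt
    for the Minkowski form is continuous near a given frame. *)

(** Since [a1 = p k - n], the upper bound on [p] amounts to [a2 > 1 - p]. The function [phi] is
    forced by requiring that [phi^(p-1)] times the density of [nu] be the radial density of [mu];
    then [a2 > 1 - p] says that [phi] outgrows [t^((k-1)/2)] at infinity, which is what its
    weak-type bound needs. For [p = 1] there is no such [phi], but [a2 >= 0] makes the two densities
    comparable pointwise.

    Statements (A) and (B) differ through [p k / 2 >= 1] alone: it is automatic for [k >= 2] and
    reads [p >= 2] for [k = 1]. Dilation needs it for an exponent to be non-negative, and thin
    shells, which compare [r^(k/2)] with [r^(1/p)], show that it cannot be avoided.

    The function [f] may change sign and is controlled only on the hyperboloid, so upper bounds pass
    through [|f|] and through a monotonicity of iterated integrals that is free of measurability. In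
    polar coordinates squares of coordinates add, so their densities convolve; the resulting Beta
    constants are never evaluated, only shown positive and finite. *)

Lemma abse_sub_le (R : realType) (a b c : \bar R) :
  (0 <= a -> 0 <= b -> a <= c -> b <= c -> `|a - b| <= c)%E.
Proof.
case: a => [a||]//; case: b => [b||]//; case: c => [c||]//=; rewrite ?leey//.
by rewrite !lee_fin => a0 b0 ac bc; rewrite ler_norml; lra.
Qed.

(** * Monotonicity and triangle inequality for arbitrary integrands *)

Section unmeasured_integral.
Local Open Scope ereal_scope.
Context d (T : measurableType d) (R : realType).
Variable mu : {measure set T -> \bar R}.
Import HBNNSimple.

(** A non-negative integral is a supremum over the simple functions below the integrand, so
    enlarging the integrand enlarges the set of competitors, measurable or not. *)
Lemma le_integral_unmeasured (D : set T) (f g : T -> \bar R) :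
  (forall x, D x -> 0 <= f x) -> (forall x, D x -> f x <= g x) ->
  \int[mu]_(x in D) f x <= \int[mu]_(x in D) g x.
Proof.
move=> f0 fg; rewrite !(integral_mkcond D).
have g0 x : D x -> 0 <= g x by move=> Dx; exact: le_trans (f0 _ Dx) (fg _ Dx).
rewrite !ge0_integralTE; [|exact: erestrict_ge0|exact: erestrict_ge0].
apply: ereal_sup_le => _ [h hf <-].
by exists h => // x; apply: (le_trans (hf x)); exact: lee_restrict.
Qed.

(** The integrals of the positive and negative parts are each bounded by that of [|f|], and a
    difference of two non-negative numbers is at most the larger one. Additivity, which would
    require measurability, is avoided. *)
Lemma le_abse_integral_unmeasured (D : set T) (f : T -> \bar R) :
  `|\int[mu]_(x in D) f x| <= \int[mu]_(x in D) `|f x|.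
Proof.
rewrite integralE.
have p0 : 0 <= \int[mu]_(x in D) f^\+ x by exact: integral_ge0.
have n0 : 0 <= \int[mu]_(x in D) f^\- x by exact: integral_ge0.
have pl : \int[mu]_(x in D) f^\+ x <= \int[mu]_(x in D) `|f x|.
  apply: le_integral_unmeasured => // x _.
  by rewrite -/((abse \o f) x) fune_abse leeDl.
have nl : \int[mu]_(x in D) f^\- x <= \int[mu]_(x in D) `|f x|.
  apply: le_integral_unmeasured => // x _.
  by rewrite -/((abse \o f) x) fune_abse leeDr.
exact: abse_sub_le.
Qed.

End unmeasured_integral.

(** * Change of variables on the line *)

Section density_pushforward.
Local Open Scope ereal_scope.
Context d1 d2 (X : measurableType d1) (Y : measurableType d2) (R : realType).
Variables (mu : {measure set X -> \bar R}) (nu : {measure set Y -> \bar R}).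
Variables (phi : X -> Y) (g : X -> R).
Hypotheses (mphi : measurable_fun setT phi) (mg : measurable_fun setT g).
Hypothesis g0 : forall x, (0 <= g x)%R.
Hypothesis nuE : forall B, measurable B ->
  nu B = \int[mu]_(x in phi @^-1` B) (g x)%:E.
Import HBNNSimple.

Lemma ge0_integral_density_pushforward (f : Y -> \bar R) :
  measurable_fun setT f -> (forall y, 0 <= f y) ->
  \int[nu]_y f y = \int[mu]_x (f (phi x) * (g x)%:E).
Proof.
move=> mf f0; pose h := nnsfun_approx measurableT mf.
have mgE : measurable_fun setT (EFin \o g) by exact/measurable_EFinP.
have mhphi n : measurable_fun setT (fun x => (h n (phi x))%:E).
  by apply/measurable_EFinP; exact: measurableT_comp.
have -> : \int[nu]_y f y = lim (\int[nu]_y (h n y)%:E @[n --> \oo]).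
  have fE y : f y = lim ((h n y)%:E @[n --> \oo]).
    by apply/esym/cvg_lim => //; exact: cvg_nnsfun_approx.
  under eq_integral do rewrite fE.
  apply: monotone_convergence => //.
  - by move=> n; apply/measurable_EFinP.
  - by move=> n x _; rewrite lee_fin.
  - by move=> x _ a b ab; rewrite lee_fin; exact/lefP/nd_nnsfun_approx.
have -> : \int[mu]_x (f (phi x) * (g x)%:E) =
    lim (\int[mu]_x ((h n (phi x))%:E * (g x)%:E) @[n --> \oo]).
  have fE x : f (phi x) * (g x)%:E =
      lim ((h n (phi x))%:E * (g x)%:E @[n --> \oo]).
    apply/esym/cvg_lim => //; apply: cvgeZr => //; exact: cvg_nnsfun_approx.
  under eq_integral do rewrite fE.
  apply: monotone_convergence => //.
  - by move=> n; apply: emeasurable_funM.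
  - by move=> n x _; rewrite mule_ge0 ?lee_fin.
  - move=> x _ a b ab; rewrite lee_wpmul2r ?lee_fin//.
    exact/lefP/nd_nnsfun_approx.
suff suf n : \int[nu]_y (h n y)%:E = \int[mu]_x ((h n (phi x))%:E * (g x)%:E).
  by under eq_fun do rewrite suf.
transitivity (\int[nu]_y
    (\sum_(r \in range (h n)) (r * \1_(h n @^-1` [set r]) y)%:E)).
  by apply: eq_integral => t tE; rewrite /= fimfunE -fsumEFin.
have mi r : measurable (h n @^-1` [set r]) by [].
have mip r : measurable (phi @^-1` (h n @^-1` [set r])).
  by rewrite -[X in measurable X]setTI; exact: mphi.
rewrite ge0_integral_fsum//; last 2 first.
  - by move=> r; apply/measurable_EFinP; exact: measurable_funM.
  - by move=> r y _; exact: nnfun_muleindic_ge0.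
transitivity (\int[mu]_x (\sum_(r \in range (h n))
    (r * \1_(h n @^-1` [set r]) (phi x))%:E * (g x)%:E)); last first.
  apply: eq_integral => x _.
  rewrite -ge0_mule_fsuml => [|y]; last exact: nnfun_muleindic_ge0.
  by rewrite fsumEFin // -fimfunE.
rewrite ge0_integral_fsum//; last 2 first.
  - move=> r; apply: emeasurable_funM => //; apply/measurable_EFinP.
    apply: measurable_funM => //.
    exact: (@measurableT_comp _ _ _ _ _ _ (\1_(h n @^-1` [set r]) : Y -> R)).
  - by move=> r x _; rewrite mule_ge0 ?lee_fin// -lee_fin nnfun_muleindic_ge0.
apply: eq_fsbigr => r /[!inE] -[y _ ry].
have r0 : (0 <= r)%R by rewrite -ry.
under eq_integral do rewrite EFinM.
rewrite integralZl_indic_nnsfun// integral_indic// setIT nuE//.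
under [RHS]eq_integral do rewrite EFinM -muleA.
rewrite ge0_integralZl//; last 2 first.
  - apply: emeasurable_funM => //; apply/measurable_EFinP.
    exact: (@measurableT_comp _ _ _ _ _ _ (\1_(h n @^-1` [set r]) : Y -> R)).
  - by move=> x _; rewrite mule_ge0 ?lee_fin.
congr (_ * _); rewrite integral_mkcond; apply: eq_integral => x _.
by rewrite epatch_indic muleC.
Qed.

End density_pushforward.

Section substitution.
Local Open Scope ereal_scope.
Variable R : realType.
Local Notation mu := (@lebesgue_measure R).
Variables (phi phi' psi : R -> R).
Hypothesis dphi : forall x, is_derive x (1%R : R) phi (phi' x).
Hypothesis cphi' : continuous phi'.
Hypothesis phi'0 : forall x, (0 <= phi' x)%R.
Hypothesis monophi : {mono phi : x y / (x < y)%R}.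
Hypothesis psiK : cancel psi phi.

Let cphi : continuous phi.
Proof. by move=> x; apply/differentiable_continuous/derivable1_diffP. Qed.

Let mphi : measurable_fun setT (phi : measurableTypeR R -> measurableTypeR R).
Proof. exact: continuous_measurable_fun. Qed.

Let mphi' : measurable_fun setT (phi' : measurableTypeR R -> R).
Proof. exact: continuous_measurable_fun. Qed.

Let m (B : set (measurableTypeR R)) := \int[mu]_(x in phi @^-1` B) (phi' x)%:E.

Let m0 : m set0 = 0.
Proof. by rewrite /m preimage_set0 integral_set0. Qed.

Let m_ge0 B : 0 <= m B.
Proof. by apply: integral_ge0 => x _; rewrite lee_fin. Qed.

Let m_add : semi_sigma_additive m.
Proof.
move=> F mF tF mUF; rewrite /m preimage_bigcup.
apply: (@semi_sigma_additive_nng_induced _ (measurableTypeR R) R mu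
  (EFin \o phi')).
- exact/measurable_EFinP.
- by move=> x; rewrite lee_fin.
- by move=> i; rewrite -[X in measurable X]setTI; exact: mphi.
- apply/trivIsetP => i j _ _ ij; rewrite -preimage_setI.
  by move/trivIsetP : tF => ->//; rewrite preimage_set0.
- rewrite -preimage_bigcup -[X in measurable X]setTI; exact: mphi.
Qed.

Let m_mixin := isMeasure.Build _ _ _ m m0 m_ge0 m_add.
Let m_measure : {measure set (measurableTypeR R) -> \bar R} := HB.pack m m_mixin.

(** By the fundamental theorem of calculus the measure [m] gives []a, b]] the mass [b - a], so it is
    Lebesgue measure. The derivative [phi'] is allowed to vanish, as that of [x |x|] does at 0. *)
Lemma ge0_integral_substitution (f : R -> \bar R) :
  measurable_fun setT f -> (forall y, 0 <= f y) ->
  \int[mu]_y f y = \int[mu]_x (f (phi x) * (phi' x)%:E).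
Proof.
move=> mf f0; apply: (ge0_integral_density_pushforward mphi mphi') => //.
apply: (@lebesgue_measure_unique R m_measure) => _ [[a b]] /= ab <-.
rewrite lebesgue_measure_itv/= /m_measure/= /m.
have -> : phi @^-1` `]a, b] = `]psi a, psi b]%classic.
  by apply/seteqP; split=> x /=;
    rewrite !in_itv/= !leNgt -(monophi (psi a)) -(monophi (psi b)) !psiK.
rewrite lte_fin; case: ltP => {}ab; last first.
  rewrite set_itv_ge ?integral_set0// bnd_simp -leNgt leNgt -monophi !psiK.
  by rewrite -leNgt.
have pab : (psi a < psi b)%R by rewrite -monophi !psiK.
rewrite integral_itv_obnd_cbnd; last first.
  apply/measurable_EFinP; exact: measurable_funTS.
rewrite (@continuous_FTC2 _ phi' phi)//.
- by rewrite !psiK.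
- exact: continuous_subspaceT.
- split.
  + by move=> x _.
  + by apply/cvg_at_right_filter/cphi.
  + by apply/cvg_at_left_filter/cphi.
- by move=> x _; rewrite derive1E; apply: derive_val.
Qed.

End substitution.

Section substitutions.
Local Open Scope ereal_scope.
Variable R : realType.
Local Notation mu := (@lebesgue_measure R).

Lemma ge0_integral_affine (a c : R) (f : R -> \bar R) : (0 < a)%R ->
  measurable_fun setT f -> (forall y, 0 <= f y) ->
  \int[mu]_y f y = a%:E * \int[mu]_x f (a * x + c)%R.
Proof.
move=> a0 mf f0.
have da x : is_derive x (1%R : R) (fun x => a * x + c)%R a.
  by apply: is_derive_eq; rewrite /GRing.scale/= ?mulr1 ?mulr0 ?addr0 ?add0r.
rewrite (@ge0_integral_substitution R (fun x => a * x + c)%R (fun=> a)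
  (fun y => (y - c) / a)%R da)//.
- rewrite -ge0_integralZl//; last 2 first.
  + apply: measurableT_comp => //.
    by apply: measurable_funD => //; apply: measurable_funM => //.
  + by rewrite lee_fin ltW.
  by apply: eq_integral => x _; rewrite muleC.
- by move=> x; exact: cvg_cst.
- by move=> x; exact: ltW.
- by move=> x y; rewrite ltrD2r ltr_pM2l.
- by move=> y; rewrite mulrC divfK ?subrK// gt_eqF.
Qed.

Lemma ge0_integral_shift (c : R) (f : R -> \bar R) :
  measurable_fun setT f -> (forall y, 0 <= f y) ->
  \int[mu]_y f y = \int[mu]_x f (x + c)%R.
Proof.
move=> mf f0; rewrite (ge0_integral_affine c ltr01 mf f0) mul1e.
by apply: eq_integral => x _; rewrite mul1r.
Qed.

Lemma ge0_integral_scale (a : R) (f : R -> \bar R) : (0 < a)%R ->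
  measurable_fun setT f -> (forall y, 0 <= f y) ->
  \int[mu]_y f y = a%:E * \int[mu]_x f (a * x)%R.
Proof.
move=> a0 mf f0; rewrite (ge0_integral_affine 0 a0 mf f0).
by under eq_integral do rewrite addr0.
Qed.

End substitutions.

(** * Iterated integrals: monotonicity, measurability in parameters, exchange *)

Section iterated_integral.
Local Open Scope ereal_scope.
Variable R : realType.
Local Notation mu := (@lebesgue_measure R).

Lemma cons_pt0 m (x : R) (v : 'I_m -> R) : cons_pt x v ord0 = x.
Proof. by rewrite /cons_pt unlift_none. Qed.

Lemma cons_ptS m (x : R) (v : 'I_m -> R) i : cons_pt x v (lift ord0 i) = v i.
Proof. by rewrite /cons_pt liftK. Qed.

Lemma sum_cons_pt m (h : 'I_m.+1 -> R -> R) (x : R) (v : 'I_m -> R) :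
  (\sum_i h i (cons_pt x v i) = h ord0 x + \sum_i h (lift ord0 i) (v i))%R.
Proof.
rewrite big_ord_recl cons_pt0; congr (_ + _)%R.
by apply: eq_bigr => i _; rewrite cons_ptS.
Qed.

Lemma sqnorm_cons_pt m (x : R) (v : 'I_m -> R) :
  sqnorm (cons_pt x v) = (x ^+ 2 + sqnorm v)%R.
Proof. exact: (sum_cons_pt (fun _ y => y ^+ 2)%R). Qed.

Lemma sqnorm_ge0 m (v : 'I_m -> R) : (0 <= sqnorm v)%R.
Proof. by apply: sumr_ge0 => i _; exact: sqr_ge0. Qed.

Lemma iintS m (F : ('I_m.+1 -> R) -> \bar R) :
  iint F = \int[mu]_x iint (fun v => F (cons_pt x v)).
Proof. by []. Qed.

Lemma iint0 m : iint (fun _ : 'I_m -> R => 0 : \bar R) = 0.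
Proof. by elim: m => //= m ->; rewrite integral0. Qed.

Lemma iint_ge0 m (F : ('I_m -> R) -> \bar R) :
  (forall v, 0 <= F v) -> 0 <= iint F.
Proof.
elim: m F => [|m IH] F F0 /=; first exact: F0.
by apply: integral_ge0 => x _; exact: IH.
Qed.

Lemma eq_iint m (F G : ('I_m -> R) -> \bar R) : F =1 G -> iint F = iint G.
Proof. by move=> /funext ->. Qed.

Lemma le_iint m (F G : ('I_m -> R) -> \bar R) :
  (forall v, 0 <= F v) -> (forall v, F v <= G v) -> iint F <= iint G.
Proof.
elim: m F G => [|m IH] F G F0 FG /=; first exact: FG.
apply: le_integral_unmeasured => x _; last exact: IH.
exact: iint_ge0.
Qed.

Lemma le_abse_iint m (F : ('I_m -> R) -> \bar R) :
  `|iint F| <= iint (fun v => `|F v|).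
Proof.
elim: m F => [|m IH] F //=.
apply: (le_trans (le_abse_integral_unmeasured _ _ _)).
by apply: le_integral_unmeasured => // x _; exact: IH.
Qed.

(* Measurability of [F t v] jointly in the parameter [t] and the coordinates
   of [v], in the curried form that matches the recursion of [iint]. *)
Fixpoint pmeasurable m : forall d (T : measurableType d),
    (T -> ('I_m -> R) -> \bar R) -> Prop :=
  match m with
  | 0 => fun d T F => measurable_fun setT (fun t => F t (fun=> 0%R))
  | m'.+1 => fun d T F =>
      @pmeasurable m' _ (T * measurableTypeR R)%type
        (fun tx v => F tx.1 (cons_pt tx.2 v))
  end.

Lemma pmeasurable_comp m d d' (T : measurableType d) (T' : measurableType d')
    (h : T' -> T) (F : T -> ('I_m -> R) -> \bar R) :
  measurable_fun setT h -> pmeasurable F -> pmeasurable (fun t => F (h t)).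
Proof.
elim: m d d' T T' h F => [|m IH] d d' T T' h F mh /= mF.
  exact: (measurableT_comp mF).
apply: (IH _ _ _ _ (fun tx : T' * measurableTypeR R => (h tx.1, tx.2)) _ _ mF).
apply: measurable_fun_pair; last exact: measurable_snd.
by apply: (measurableT_comp mh); exact: measurable_fst.
Qed.

Lemma measurable_fun_iint m d (T : measurableType d)
    (F : T -> ('I_m -> R) -> \bar R) :
  (forall t v, 0 <= F t v) -> pmeasurable F ->
  measurable_fun setT (fun t => iint (F t)).
Proof.
elim: m d T F => [|m IH] d T F F0 //= mF.
apply: (@measurable_fun_fubini_tonelli_F _ _ T (measurableTypeR R) R mu
  (fun tx => iint (fun v => F tx.1 (cons_pt tx.2 v)))).
  exact: IH mF.
by move=> tx; exact: iint_ge0.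
Qed.

Lemma iint_swap m (F : measurableTypeR R -> ('I_m -> R) -> \bar R) :
  (forall t v, 0 <= F t v) -> pmeasurable F ->
  \int[mu]_x iint (F x) = iint (fun v => \int[mu]_x F x v).
Proof.
elim: m F => [|m IH] F F0 //= mF.
rewrite (@fubini_tonelli _ _ (measurableTypeR R) (measurableTypeR R) R mu mu
  (fun tx => iint (fun v => F tx.1 (cons_pt tx.2 v)))).
- apply: eq_integral => y _ /=; rewrite IH//.
  apply: (pmeasurable_comp
    (h := fun x : measurableTypeR R => (x, y : measurableTypeR R)) _ mF).
  exact: measurable_fun_pair.
- exact: (measurable_fun_iint _ mF).
- by move=> tx; exact: iint_ge0.
Qed.

(** This class of integrands is closed under the recursion: splitting off a coordinate adds its
    square to [|v|^2] and a multiple of it to the linear form, and both terms pass into the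
    parameter. *)
Lemma pmeasurable_quad m d (T : measurableType d) (b : 'I_m -> R)
    (G : T * (measurableTypeR R * measurableTypeR R) -> \bar R) :
  measurable_fun setT G ->
  pmeasurable (fun t v => G (t, (sqnorm v, \sum_i b i * v i)%R)).
Proof.
elim: m d T b G => [|m IH] d T b G mG /=.
  apply: (measurableT_comp mG).
  by do 2![apply: measurable_fun_pair => //].
pose h (z : (T * measurableTypeR R) * (measurableTypeR R * measurableTypeR R)) :
    T * (measurableTypeR R * measurableTypeR R) :=
  (z.1.1, (z.1.2 ^+ 2 + z.2.1, b ord0 * z.1.2 + z.2.2)%R).
have mh : measurable_fun setT h.
  have m12 : measurable_fun setT (fun z : (T * measurableTypeR R) *
      (measurableTypeR R * measurableTypeR R) => z.1.2 : R).
    exact: (measurableT_comp measurable_snd measurable_fst).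
  apply: measurable_fun_pair.
    exact: (measurableT_comp measurable_fst measurable_fst).
  apply: measurable_fun_pair.
    apply: measurable_funD; first exact: measurable_funX.
    exact: (measurableT_comp measurable_fst measurable_snd).
  apply: measurable_funD; first exact: measurable_funM.
  exact: (measurableT_comp measurable_snd measurable_snd).
have := IH _ _ (fun i => b (lift ord0 i)) (G \o h) (measurableT_comp mG mh).
rewrite /h/=; congr (pmeasurable _); apply/funext => -[t x]; apply/funext => v /=.
by rewrite sqnorm_cons_pt (sum_cons_pt (fun i y => b i * y)%R).
Qed.

Lemma iint_box m (a b : 'I_m -> R) : (forall i, a i <= b i)%R ->
  iint (fun x => (\1_[set x | forall i, a i < x i < b i] x)%:E) =
  (\prod_i (b i - a i))%:E.
Proof.
elim: m a b => [|m IH] a b ab /=.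
  rewrite big_ord0 indicE mem_set//; by case.
have E x : iint (fun v : 'I_m -> R =>
      (\1_[set x | forall i, a i < x i < b i]%R (cons_pt x v))%:E) =
    (\prod_i (b (lift ord0 i) - a (lift ord0 i)))%:E *
      (\1_(`]a ord0, b ord0[%classic : set (measurableTypeR R)) x)%:E.
  rewrite !indicE mem_setE in_itv/=; case: (boolP (_ < x < _)%R) => xab.
    rewrite mule1 -IH//; apply: eq_iint => v; rewrite !indicE.
    congr ((nat_of_bool _)%:R%:E); apply/idP/idP; rewrite !inE/= => H.
      by move=> i; have := H (lift ord0 i); rewrite cons_ptS.
    by move=> i; case: (unliftP ord0 i) => [j|] ->; rewrite ?cons_ptS ?cons_pt0.
  rewrite mule0 -[RHS](iint0 m); apply: eq_iint => v.
  by rewrite indicE memNset//= => /(_ ord0); rewrite cons_pt0; exact/negP.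
under eq_integral do rewrite E.
rewrite ge0_integralZl//.
- rewrite integral_indic// setIT/= lebesgue_measure_itv/= lte_fin.
  rewrite big_ord_recl muleC; case: ltP => [_//|ba].
  rewrite mul0e (_ : b ord0 = a ord0) ?subrr ?mul0r//.
  by apply/eqP; rewrite eq_le ba ab.
- exact/measurable_EFinP.
- by rewrite lee_fin prodr_ge0// => i _; rewrite subr_ge0.
Qed.

End iterated_integral.

(** * Hyperbolic functions, the signed square and power densities *)

Section real_functions.
Variable R : realType.

Lemma coshR_gt0 (t : R) : 0 < coshR t.
Proof. by rewrite divr_gt0// addr_gt0 ?expR_gt0. Qed.

Lemma coshR2_sinhR2 (t : R) : coshR t ^+ 2 - sinhR t ^+ 2 = 1.
Proof.
rewrite /coshR /sinhR expRN.
have /lt0r_neq0 e0 := expR_gt0 t.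
by field.
Qed.

Lemma coshRD (s t : R) : coshR (s + t) = coshR s * coshR t + sinhR s * sinhR t.
Proof.
rewrite /coshR /sinhR opprD !expRD !expRN.
have /lt0r_neq0 e0 := expR_gt0 t; have /lt0r_neq0 f0 := expR_gt0 s.
by field; rewrite e0 f0.
Qed.

Lemma ltr_sinhR : {mono @sinhR R : x y / x < y}.
Proof.
apply: leW_mono; apply: le_mono => x y xy.
by rewrite ltr_pM2r ?invr_gt0// ltrB// ltr_expR// ltrN2.
Qed.

Lemma is_derive_sinhR (x : R) : is_derive x 1 (@sinhR R) (coshR x).
Proof.
apply: is_derive_eq; rewrite /coshR /GRing.scale/=.
by field.
Qed.

Lemma continuous_coshR : continuous (@coshR R).
Proof.
move=> x; apply: cvgM; last exact: cvg_cst.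
apply: cvgD; first exact: continuous_expR.
by apply: continuous_comp; [exact: opp_continuous|exact: continuous_expR].
Qed.

Definition asinhR (y : R) := ln (y + Num.sqrt (y ^+ 2 + 1)).

Lemma asinhR_arg_gt0 (y : R) : 0 < y + Num.sqrt (y ^+ 2 + 1).
Proof.
rewrite addrC -ltrBlDr sub0r (le_lt_trans (ler_norm _))// normrN -sqrtr_sqr.
by rewrite ltr_sqrt ?ltrDl ?ltr_pwDr ?sqr_ge0.
Qed.

Lemma asinhRK : cancel asinhR (@sinhR R).
Proof.
move=> y; rewrite /sinhR expRN lnK ?posrE ?asinhR_arg_gt0//.
have := asinhR_arg_gt0 y; set s := Num.sqrt _ => ys.
have s2 : s ^+ 2 = y ^+ 2 + 1 by rewrite sqr_sqrtr// addr_ge0 ?sqr_ge0.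
have -> : (y + s)^-1 = s - y.
  apply/(mulfI (lt0r_neq0 ys)); rewrite mulfV ?lt0r_neq0//.
  have -> : (y + s) * (s - y) = s ^+ 2 - y ^+ 2 by ring.
  by rewrite s2; ring.
by field.
Qed.

(** The map [x |x|] is an increasing bijection of the line that agrees with the square on the
    positive half, so the substitution [t = x^2] falls under the formula for the whole line. *)
Lemma is_derive_mul_norm (x : R) :
  is_derive x 1 (fun x : R => x * `|x|) (2 * `|x|).
Proof.
(* The derivative [2 |x|] is 2-Lipschitz, so the remainder is at most [h^2], even when [x] and
   [h + x] have opposite signs. *)
have key (h : R) : h != 0 ->
    `|2 * `|x| - h^-1 * ((h + x) * `|h + x| - x * `|x|)| <= `|h|.
  move=> h0; have hn : 0 < `|h| by rewrite normr_gt0.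
  have -> : 2 * `|x| - h^-1 * ((h + x) * `|h + x| - x * `|x|) =
      h^-1 * (2 * `|x| * h - ((h + x) * `|h + x| - x * `|x|)) by field.
  rewrite normrM normfV mulrC ler_pdivrMr// -normrM -expr2 [X in _ <= X]ger0_norm ?sqr_ge0//.
  rewrite ler_norml; apply/andP.
  by case: (ger0P x) => ?; case: (ger0P (h + x)) => ?; split; nra.
suff H : (fun h : R => h^-1 *: (((h *: (1 : R) + x) * `|h *: (1 : R) + x|)
    - x * `|x|)) @ 0^' --> 2 * `|x|.
  split; first by apply/cvg_ex; exists (2 * `|x|).
  by apply/cvg_lim.
apply/cvgrPdist_le => e e0; near=> h.
rewrite /GRing.scale/= mulr1; apply: (le_trans (key h _)).
  by near: h; exact: nbhs_dnbhs_neq.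
near: h; apply/nbhs_dnbhs; exists e => //= z /=.
by rewrite sub0r normrN => /ltW.
Unshelve. all: by end_near. Qed.

Lemma ltr_mul_norm : {mono (fun x : R => x * `|x|) : x y / x < y}.
Proof.
apply: leW_mono; apply: le_mono => x y xy /=.
by case: (ger0P x) => ?; case: (ger0P y) => ?; nra.
Qed.

Definition ssqrt (y : R) : R := Num.sg y * Num.sqrt `|y|.

Lemma ssqrtK : cancel ssqrt (fun x : R => x * `|x|).
Proof.
move=> y; rewrite /ssqrt normrM (ger0_norm (sqrtr_ge0 _)) mulrACA -expr2.
rewrite sqr_sqrtr// normr_sg; case: (ltgtP y 0) => [y0|y0|->].
- by rewrite ltr0_sg//= mulr1 ltr0_norm// mulN1r opprK.
- by rewrite gtr0_sg//= mulr1 gtr0_norm// mul1r.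
- by rewrite normr0 mulr0.
Qed.

(* [t ^ (a - 1)] on the half-line [t > 0], extended by [0] *)
Definition tpow (a t : R) : R := if 0 < t then t `^ (a - 1) else 0.

Lemma tpow_ge0 a t : 0 <= tpow a t.
Proof. by rewrite /tpow; case: ifP => // _; exact: powR_ge0. Qed.

Lemma measurable_tpow a : measurable_fun setT (tpow a).
Proof.
apply: measurable_fun_ifT => //=; exact: measurable_fun_ltr.
Qed.

Lemma tpowM a c t : 0 < c -> tpow a (c * t) = c `^ (a - 1) * tpow a t.
Proof.
move=> c0; rewrite /tpow pmulr_rgt0//; case: ifP => t0; last by rewrite mulr0.
by rewrite powRM// ltW.
Qed.

End real_functions.

Section square_sinh_substitution.
Local Open Scope ereal_scope.
Variable R : realType.
Local Notation mu := (@lebesgue_measure R).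
Variable G : R -> \bar R.
Hypotheses (mG : measurable_fun setT G) (G0 : forall y, 0 <= G y).

Lemma ge0_integral_sinhR (w : R) : (0 < w)%R ->
  \int[mu]_y G y = \int[mu]_t (G (w * sinhR t)%R * (w * coshR t)%:E).
Proof.
move=> w0.
have dw t : is_derive t (1%R : R) (fun t => w * sinhR t)%R (w * coshR t)%R.
  have ? := is_derive_sinhR t.
  by apply: is_derive_eq; rewrite /GRing.scale/= ?mulr0 ?addr0 ?add0r.
rewrite (@ge0_integral_substitution R (fun t => w * sinhR t)%R
  (fun t => w * coshR t)%R (fun y => asinhR (y / w)) dw)//.
- by move=> t; apply: cvgM; [exact: cvg_cst|exact: continuous_coshR].
- by move=> t; rewrite mulr_ge0 ?ltW ?coshR_gt0.
- by move=> s t; rewrite ltr_pM2l// ltr_sinhR.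
- by move=> y; rewrite asinhRK mulrC divfK ?gt_eqF.
Qed.

Lemma ge0_integral_sqr :
  \int[mu]_x G (x ^+ 2)%R = \int[mu]_t (G t * (tpow 2^-1 t)%:E).
Proof.
have mG2 : measurable_fun setT (fun x : R => G (x ^+ 2)%R).
  by apply: measurableT_comp => //; exact: measurable_funX.
have dw t : is_derive t (1%R : R) (fun x : R => x * `|x|)%R (2 * `|t|)%R.
  exact: is_derive_mul_norm.
have cd : continuous (fun t : R => 2 * `|t|)%R.
  by move=> x; apply: cvgM; [exact: cvg_cst|exact: norm_continuous].
have d0 (t : R) : (0 <= 2 * `|t|)%R by rewrite mulr_ge0.
have mGt : measurable_fun setT (fun t => G t * (tpow 2^-1 t)%:E).
  by apply: emeasurable_funM => //; apply/measurable_EFinP; exact: measurable_tpow.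
have Gt0 t : 0 <= G t * (tpow 2^-1 t)%:E by rewrite mule_ge0// lee_fin tpow_ge0.
rewrite (ge0_integral_substitution dw cd d0 (@ltr_mul_norm R) (@ssqrtK R) mGt Gt0).
(* By evenness the two half-lines contribute equally on the left, whence a factor 2. On the right
   the weight is [2 |x|] times [(x^2)^(-1/2)], which is 2 for [x > 0], while [tpow] kills [x <= 0];
   so no constant remains. *)
have -> : [set: R] = `]-oo, 0%R] `|` `]0%R, +oo[%classic.
  by apply/seteqP; split => x //= _; rewrite !in_itv/= andbT; case: (leP x 0%R); [left|right].
rewrite (_ : \int[mu]_(x in (`]-oo, 0%R] `|` `]0%R, +oo[)) G (x ^+ 2)%R =
  \int[mu]_(x in `]0%R, +oo[) (2%:E * G (x ^+ 2)%R)); last first.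
  rewrite ge0_integral_setU//=.
  - rewrite ge0_integralZl//; last exact: measurable_funTS.
    have -> : \int[mu]_(x in `]-oo, 0%R]) G (x ^+ 2)%R = \int[mu]_(x in `]0%R, +oo[) G (x ^+ 2)%R.
      rewrite integral_itv_obnd_cbnd; last exact: measurable_funTS.
      rewrite ge0_integration_by_substitution0//.
      by apply: eq_integral => x _; rewrite sqrrN.
    by rewrite [X in X%:E * _](_ : _ = 1 + 1)%R// EFinD ge0_muleDl ?mul1e.
  - exact: measurable_funTS.
  - rewrite disj_set2E; apply/eqP; rewrite -subset0 => x []/= /[!in_itv]/=.
    by rewrite leNgt andbT => /negP.
rewrite [RHS]integral_mkcond [LHS]integral_mkcond; apply: eq_integral => x _.
rewrite !patchE.
have [x0|x0] := ltP 0%R x.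
  rewrite !mem_set/=; last 2 first.
  - by right; rewrite /= in_itv/= x0.
  - by rewrite /= in_itv/= x0.
  rewrite gtr0_norm// /tpow -expr2 exprn_gt0// -muleA muleC -EFinM.
  congr (_ * _%:E); rewrite -(powR_mulrn 2) ?ltW// -powRrM.
  rewrite (_ : 2%:R * (2^-1 - 1) = -1 :> R)%R; last by field.
  by rewrite powR_inv1 ?ltW//; field; rewrite gt_eqF.
rewrite memNset/=; last by rewrite in_itv/= andbT ltNge x0.
case: ifP => // _; rewrite /tpow ltNge (_ : x * `|x| <= 0)%R ?mulr_le0_ge0//=.
by rewrite mule0 mul0e.
Qed.


End square_sinh_substitution.

(** * Lorentz invariance of the volume of the hyperboloid *)

Section lorentz_invariance.
Local Open Scope ereal_scope.
Variable R : realType.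
Local Notation mu := (@lebesgue_measure R).

Lemma measurable_sqrtr : measurable_fun [set: R] (@Num.sqrt R).
Proof. by apply: continuous_measurable_fun => x; exact: sqrt_continuous. Qed.

Lemma measurable_invr_sqrt d (T : measurableType d) (f : T -> R) :
  measurable_fun setT f -> measurable_fun setT (fun t => (Num.sqrt (f t))^-1)%R.
Proof.
move=> mf; rewrite (_ : (fun t => _) = (fun t => Num.sqrt (f t) `^ (-1))%R).
  apply: (measurableT_comp (measurable_powR (-1 : R)%R)).
  exact: (measurableT_comp measurable_sqrtr).
by apply/funext => t; rewrite powR_inv1// sqrtr_ge0.
Qed.

(* The substitution [x = w sinh t] turns a boost in one variable into a
   translation of [t]. *)
Lemma ge0_integral_boost (a b w : R) (G : R -> \bar R) :
  measurable_fun setT G -> (forall y, 0 <= G y) ->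
  (0 < w)%R -> (0 < a)%R -> (b ^+ 2 < a ^+ 2)%R ->
  \int[mu]_x (G (a * Num.sqrt (w + x ^+ 2) + b * x)%R *
    ((Num.sqrt (w + x ^+ 2))^-1)%:E) =
  \int[mu]_x (G (Num.sqrt (a ^+ 2 - b ^+ 2) * Num.sqrt (w + x ^+ 2))%R *
    ((Num.sqrt (w + x ^+ 2))^-1)%:E).
Proof.
move=> mG G0 w0 a0 ba.
set A := Num.sqrt (_ - _).
have A0 : (0 < A)%R by rewrite sqrtr_gt0 subr_gt0.
have A2 : (A ^+ 2 = a ^+ 2 - b ^+ 2)%R by rewrite sqr_sqrtr// subr_ge0 ltW.
have sw0 : (0 < Num.sqrt w)%R by rewrite sqrtr_gt0.
have mw : measurable_fun setT (fun x : R => w + x ^+ 2)%R.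
  by apply: measurable_funD => //; exact: measurable_funX.
have sE t : Num.sqrt (w + (Num.sqrt w * sinhR t) ^+ 2) =
    (Num.sqrt w * coshR t)%R.
  rewrite exprMn sqr_sqrtr ?ltW// -{1}(mulr1 w) -mulrDr.
  have -> : (1 + sinhR t ^+ 2 = coshR t ^+ 2)%R.
    by have := coshR2_sinhR2 t; lra.
  by rewrite sqrtrM ?ltW// sqrtr_sqr gtr0_norm// coshR_gt0.
have red (c e : R) : \int[mu]_x (G (c * Num.sqrt (w + x ^+ 2) + e * x)%R *
    ((Num.sqrt (w + x ^+ 2))^-1)%:E) =
    \int[mu]_t G (Num.sqrt w * (c * coshR t + e * sinhR t))%R.
  rewrite (@ge0_integral_sinhR R _ _ _ (Num.sqrt w))//; last 2 first.
  - apply: emeasurable_funM.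
      apply: measurableT_comp => //; apply: measurable_funD.
        apply: measurable_funM => //.
        exact: (measurableT_comp measurable_sqrtr).
      exact: measurable_funM.
    by apply/measurable_EFinP; exact: measurable_invr_sqrt.
  - by move=> y; rewrite mule_ge0// lee_fin invr_ge0 sqrtr_ge0.
  apply: eq_integral => t _; rewrite sE -muleA -EFinM mulVf; last first.
    by rewrite mulf_neq0// gt_eqF// coshR_gt0.
  by rewrite mule1; congr G; ring.
rewrite red.
transitivity (\int[mu]_x (G (A * Num.sqrt (w + x ^+ 2) + 0 * x)%R *
    ((Num.sqrt (w + x ^+ 2))^-1)%:E)); last first.
  by under eq_integral do rewrite mul0r addr0.
(* [t0] is the rapidity of the boost: [a = A cosh t0] and [b = A sinh t0], so
   [a cosh t + b sinh t = A cosh (t + t0)]. *)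
rewrite red; pose t0 := asinhR (b / A).
have st0 : (A * sinhR t0 = b)%R by rewrite asinhRK mulrC divfK// gt_eqF.
have ct0 : (A * coshR t0 = a)%R.
  apply/eqP; rewrite -(@eqrXn2 _ 2)//; last 2 first.
  - by rewrite mulr_ge0 ?ltW// coshR_gt0.
  - exact: ltW.
  rewrite exprMn; have -> : (coshR t0 ^+ 2 = 1 + sinhR t0 ^+ 2)%R.
    by have := coshR2_sinhR2 t0; lra.
  by rewrite mulrDr mulr1 -exprMn st0 A2 subrK.
rewrite [RHS](ge0_integral_shift t0)//.
- apply: eq_integral => t _; congr G; congr (_ * _)%R.
  by rewrite mul0r addr0 coshRD mulrDr -{1}ct0 -{1}st0; ring.
- apply: measurableT_comp => //; apply: continuous_measurable_fun => t.
  apply: cvgM; first exact: cvg_cst.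
  under eq_fun do rewrite mul0r addr0.
  rewrite mul0r addr0.
  by apply: cvgM; [exact: cvg_cst|exact: continuous_coshR].
Qed.

(** The reason for an arbitrary [w] is the induction: with the first coordinate [x] frozen, the
    induction hypothesis for [w + x^2] and a translate of [G] removes the other coefficients of the
    linear form and turns [a] into [A]. After an exchange of integrals the one-variable boost in [x]
    removes [b ord0]. *)
Lemma iint_boost m (w a : R) (b : 'I_m -> R) (G : R -> \bar R) :
  measurable_fun setT G -> (forall y, 0 <= G y) ->
  (0 < w)%R -> (0 < a)%R -> (sqnorm b < a ^+ 2)%R ->
  iint (fun v : 'I_m -> R => G (a * Num.sqrt (w + sqnorm v) + \sum_i b i * v i)%R *
    ((Num.sqrt (w + sqnorm v))^-1)%:E) =
  iint (fun v : 'I_m -> R => G (Num.sqrt (a ^+ 2 - sqnorm b) * Num.sqrt (w + sqnorm v))%R *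
    ((Num.sqrt (w + sqnorm v))^-1)%:E).
Proof.
elim: m w b G => [|m IH] w b G mG G0 w0 a0 ba /=.
  by rewrite [X in (_ + X)%R]big_ord0 [sqnorm b]big_ord0 addr0 subr0 sqrtr_sqr gtr0_norm.
have sbE : (sqnorm b = b ord0 ^+ 2 + sqnorm (fun i => b (lift ord0 i)))%R.
  by rewrite /sqnorm big_ord_recl.
set b' := fun i => b (lift ord0 i) in sbE *.
have b'a : (sqnorm b' < a ^+ 2)%R.
  by apply: le_lt_trans ba; rewrite sbE lerDr sqr_ge0.
pose A := Num.sqrt (a ^+ 2 - sqnorm b').
have A0 : (0 < A)%R by rewrite sqrtr_gt0 subr_gt0.
have A2 : (A ^+ 2 = a ^+ 2 - sqnorm b')%R by rewrite sqr_sqrtr// subr_ge0 ltW.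
have meas (c e : R) : pmeasurable (fun (x : measurableTypeR R) (v : 'I_m -> R) =>
    G (c * Num.sqrt (w + x ^+ 2 + sqnorm v) + e * x)%R *
      ((Num.sqrt (w + x ^+ 2 + sqnorm v))^-1)%:E).
  apply: (@pmeasurable_quad R m _ (measurableTypeR R) (fun=> 0%R)
    (fun z : measurableTypeR R * (measurableTypeR R * measurableTypeR R) =>
    G (c * Num.sqrt (w + z.1 ^+ 2 + z.2.1) + e * z.1)%R *
      ((Num.sqrt (w + z.1 ^+ 2 + z.2.1))^-1)%:E)).
  have m1 : measurable_fun setT (fun z : measurableTypeR R *
    (measurableTypeR R * measurableTypeR R) => w + z.1 ^+ 2 + z.2.1 : R)%R.
    apply: measurable_funD.
      by apply: measurable_funD => //; exact: measurable_funX.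
    exact: (measurableT_comp measurable_fst measurable_snd).
  apply: emeasurable_funM; last first.
    by apply/measurable_EFinP; exact: measurable_invr_sqrt.
  apply: measurableT_comp => //; apply: measurable_funD.
    apply: measurable_funM => //; exact: (measurableT_comp measurable_sqrtr).
  exact: measurable_funM.
have pos (c e : R) (x : R) (v : 'I_m -> R) :
    0 <= G (c * Num.sqrt (w + x ^+ 2 + sqnorm v) + e * x)%R *
      ((Num.sqrt (w + x ^+ 2 + sqnorm v))^-1)%:E.
  by rewrite mule_ge0// lee_fin invr_ge0 sqrtr_ge0.
transitivity (\int[mu]_x iint (fun v : 'I_m -> R =>
    G (A * Num.sqrt (w + x ^+ 2 + sqnorm v) + b ord0 * x)%R *
      ((Num.sqrt (w + x ^+ 2 + sqnorm v))^-1)%:E)).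
  apply: eq_integral => x _.
  rewrite -(IH (w + x ^+ 2)%R b' (fun y => G (y + b ord0 * x)%R))//.
  - apply: eq_iint => v; rewrite sqnorm_cons_pt addrA.
    rewrite (sum_cons_pt (fun i y => b i * y)%R); congr (G _ * _); ring.
  - by apply: measurableT_comp => //; exact: measurable_funD.
  - by rewrite ltr_pwDl// sqr_ge0.
rewrite iint_swap//.
transitivity (\int[mu]_x iint (fun v : 'I_m -> R =>
    G (Num.sqrt (a ^+ 2 - sqnorm b) * Num.sqrt (w + x ^+ 2 + sqnorm v) + 0 * x)%R *
      ((Num.sqrt (w + x ^+ 2 + sqnorm v))^-1)%:E)); last first.
  apply: eq_integral => x _; apply: eq_iint => v.
  by rewrite sqnorm_cons_pt addrA mul0r addr0.
rewrite iint_swap//; apply: eq_iint => v.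
have AE : (a ^+ 2 - sqnorm b = A ^+ 2 - b ord0 ^+ 2)%R by rewrite A2 sbE; ring.
rewrite AE.
have := @ge0_integral_boost A (b ord0) (w + sqnorm v) G mG G0.
have -> : (fun x => G (A * Num.sqrt (w + sqnorm v + x ^+ 2) + b ord0 * x)%R *
    ((Num.sqrt (w + sqnorm v + x ^+ 2))^-1)%:E) =
  (fun x => G (A * Num.sqrt (w + x ^+ 2 + sqnorm v) + b ord0 * x)%R *
    ((Num.sqrt (w + x ^+ 2 + sqnorm v))^-1)%:E).
  by apply/funext => x; rewrite (addrAC w).
move=> ->//.
- by apply: eq_integral => x _; rewrite (addrAC w) mul0r addr0.
- by rewrite ltr_pwDl// sqnorm_ge0.
- by rewrite -subr_gt0 -AE subr_gt0.
Qed.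

End lorentz_invariance.

(** * Polar coordinates *)

Section polar.
Local Open Scope ereal_scope.
Variable R : realType.
Local Notation mu := (@lebesgue_measure R).

(** The cube of half-side [1 / (m + 2)] lies in the unit ball. Together with finiteness, obtained
    from a circumscribed cube, this controls the polar constant without computing it. *)
Lemma iint_ball_gt0 m :
  0 < iint (fun v : 'I_m.+1 -> R => (\1_[set t : R | t < 1]%R (sqnorm v))%:E).
Proof.
pose e : R := (m.+2%:R)^-1%R.
have e0 : (0 < e)%R by rewrite invr_gt0.
apply: (@lt_le_trans _ _ (iint (fun x : 'I_m.+1 -> R =>
    (\1_[set x | forall i, - e < x i < e] x)%:E)%R)).
  rewrite iint_box; last by move=> i; lra.
  by rewrite lte_fin prodr_gt0// => i _; rewrite opprK addr_gt0.
apply: le_iint => v; first by rewrite lee_fin.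
rewrite !indicE lee_fin ler_nat; case: (boolP (v \in _)) => // /[!inE]/= H.
rewrite mem_set//=; apply: (@le_lt_trans _ _ (\sum_(i < m.+1) e ^+ 2)%R).
  apply: ler_sum => i _; rewrite -real_normK ?num_real// lerXn2r ?nnegrE//.
    exact: ltW.
  by rewrite ler_norml; have /andP[/ltW -> /ltW ->] := H i.
rewrite sumr_const card_ord -mulr_natl expr2 mulrA.
have ee : (e <= 1)%R by rewrite invf_le1// ler1n.
apply: (@le_lt_trans _ _ (m.+1%:R * e)%R).
  by rewrite ler_piMr// mulr_ge0// ltW.
by rewrite ltr_pdivrMr// mul1r ltr_nat.
Qed.

Lemma iint_ball_lty m :
  iint (fun v : 'I_m.+1 -> R => (\1_[set t : R | t < 1]%R (sqnorm v))%:E) < +oo.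
Proof.
apply: (@le_lt_trans _ _ (iint (fun x : 'I_m.+1 -> R =>
    (\1_[set x | forall i, - 1 < x i < 1] x)%:E)%R)); last first.
  by rewrite iint_box ?ltry// => i; lra.
apply: le_iint => v; first by rewrite lee_fin.
rewrite !indicE lee_fin ler_nat; case: (boolP (sqnorm v \in _)) => // /[!inE]/= H.
rewrite mem_set//= => i; rewrite -ltr_norml -(@ltr_pXn2r _ 2)// ?nnegrE//.
rewrite real_normK ?num_real// expr1n (le_lt_trans _ H)//.
by rewrite /sqnorm (bigD1 i)//= lerDl sumr_ge0// => j _; exact: sqr_ge0.
Qed.

Lemma measurable_conv_tpow (a b : R) (G : R -> \bar R) :
  measurable_fun setT G ->
  measurable_fun setT (fun z : measurableTypeR R * measurableTypeR R =>
    G z.2 * (tpow a (z.2 - z.1) * tpow b z.1)%:E).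
Proof.
move=> mG; apply: emeasurable_funM; first exact: measurableT_comp.
apply/measurable_EFinP; apply: measurable_funM.
  apply: (measurableT_comp (measurable_tpow a)).
  by apply: measurable_funB.
exact: (measurableT_comp (measurable_tpow b)).
Qed.

(** Scaling the variable by [tau] shows that the convolution is homogeneous of degree [a + b - 1].
    The factor is a Beta integral, which at this stage may be infinite. *)
Lemma conv_tpow (a b tau : R) :
  \int[mu]_s (tpow a (tau - s) * tpow b s)%:E =
  (\int[mu]_s (tpow a (1 - s) * tpow b s)%:E) * (tpow (a + b) tau)%:E.
Proof.
have mconv (c : R) : measurable_fun setT (fun s : R => (tpow a (c - s) * tpow b s)%:E).
  apply/measurable_EFinP; apply: measurable_funM; last exact: measurable_tpow.
  by apply: (measurableT_comp (measurable_tpow a)); exact: measurable_funB.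
have c0 (c : R) : forall s : R, 0 <= (tpow a (c - s) * tpow b s)%:E.
  by move=> s; rewrite lee_fin mulr_ge0 ?tpow_ge0.
have [t0|t0] := ltP 0%R tau; last first.
  rewrite [tpow (a + b) _]/tpow ltNge t0 mule0 integral0_eq// => s _.
  rewrite /tpow; case: ifP => // h1; case: ifP => // h2; rewrite ?mulr0 ?mul0r//.
  by exfalso; lra.
rewrite (ge0_integral_scale t0)//.
transitivity (tau%:E * \int[mu]_x ((tau `^ (a - 1) * tau `^ (b - 1))%:E *
    (tpow a (1 - x) * tpow b x)%:E)).
  congr (_ * _); apply: eq_integral => x _; rewrite -EFinM; congr (_%:E).
  rewrite (_ : tau - tau * x = tau * (1 - x))%R; last by ring.
  by rewrite !tpowM//; ring.
rewrite ge0_integralZl//; [|exact: mconv|by rewrite lee_fin mulr_ge0 ?powR_ge0].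
rewrite muleA -EFinM muleC; congr (_ * _%:E).
have tn0 : tau != 0%R by rewrite gt_eqF.
rewrite /tpow t0 -{1}(powRr1 (ltW t0)) -!powRD ?tn0 ?implybT//.
by congr (_ `^ _)%R; ring.
Qed.

(** The density of [|v|^2] under Lebesgue measure is found by induction on the dimension: a new
    squared coordinate has density [t^(-1/2)], and adding it convolves the densities. *)
Lemma iint_polar m : exists c : R, (0 < c)%R /\
  forall G : R -> \bar R, measurable_fun setT G -> (forall y, 0 <= G y) ->
  iint (fun v : 'I_m.+1 -> R => G (sqnorm v)) =
  c%:E * \int[mu]_t (G t * (tpow (m.+1%:R / 2) t)%:E).
Proof.
elim: m => [|m [c [c0 IH]]].
  exists 1%R; split=> // G mG G0; rewrite mul1e mul1r -ge0_integral_sqr//=.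
  apply: eq_integral => x _; rewrite sqnorm_cons_pt [X in (_ + X)%R]big_ord0.
  by rewrite addr0.
set al := (m.+1%:R / 2)%R in IH.
pose B := \int[mu]_s (tpow al (1 - s) * tpow 2^-1 s)%:E.
have B0 : 0 <= B.
  by apply: integral_ge0 => s _; rewrite lee_fin mulr_ge0 ?tpow_ge0.
have alE : (m.+2%:R / 2 = al + 2^-1 :> R)%R by rewrite /al; field.
have key (G : R -> \bar R) : measurable_fun setT G -> (forall y, 0 <= G y) ->
    iint (fun v : 'I_m.+2 -> R => G (sqnorm v)) =
    c%:E * (B * \int[mu]_t (G t * (tpow (m.+2%:R / 2) t)%:E)).
  move=> mG G0; rewrite iintS.
  have mG2 : measurable_fun setT (fun z : measurableTypeR R * measurableTypeR R =>
      G (z.1 + z.2)%R * (tpow al z.2)%:E).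
    apply: emeasurable_funM.
      by apply: (measurableT_comp mG); exact: measurable_funD.
    by apply/measurable_EFinP; exact: (measurableT_comp (measurable_tpow al)).
  have mG1 : measurable_fun setT (fun s : R => \int[mu]_t (G (s + t)%R * (tpow al t)%:E)).
    apply: (@measurable_fun_fubini_tonelli_F _ _ (measurableTypeR R)
      (measurableTypeR R) R mu _ mG2) => z.
    by rewrite mule_ge0// lee_fin tpow_ge0.
  have G10 s : 0 <= \int[mu]_t (G (s + t)%R * (tpow al t)%:E).
    by apply: integral_ge0 => t _; rewrite mule_ge0// lee_fin tpow_ge0.
  transitivity (\int[mu]_x (c%:E * \int[mu]_t (G (x ^+ 2 + t)%R * (tpow al t)%:E))).
    apply: eq_integral => x _; rewrite -(IH (fun t => G (x ^+ 2 + t)%R))//.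
    - by apply: eq_iint => v; rewrite sqnorm_cons_pt.
    - by apply: (measurableT_comp mG); exact: measurable_funD.
  rewrite ge0_integralZl//; last 2 first.
  - apply: (measurableT_comp mG1); exact: measurable_funX.
  - by rewrite lee_fin ltW.
  congr (_ * _).
  rewrite (ge0_integral_sqr mG1 G10).
  transitivity (\int[mu]_s \int[mu]_t (G t * (tpow al (t - s) * tpow 2^-1 s)%:E)).
    apply: eq_integral => s _.
    have msh : measurable_fun setT (fun t : R => G t * (tpow al (t - s) * tpow 2^-1 s)%:E).
      apply: emeasurable_funM => //; apply/measurable_EFinP; apply: measurable_funM => //.
      by apply: (measurableT_comp (measurable_tpow al)); exact: measurable_funB.
    rewrite (ge0_integral_shift s msh); last first.
      by move=> t; rewrite mule_ge0// lee_fin mulr_ge0 ?tpow_ge0.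
    rewrite muleC -ge0_integralZl//; last 3 first.
    - apply: emeasurable_funM.
        by apply: (measurableT_comp mG); exact: measurable_funD.
      by apply/measurable_EFinP; exact: measurable_tpow.
    - by move=> t _; rewrite mule_ge0// lee_fin tpow_ge0.
    - by rewrite lee_fin tpow_ge0.
    apply: eq_integral => t _; rewrite addrK muleC -muleA EFinM; congr (G _ * _).
    by rewrite addrC.
  rewrite (@fubini_tonelli _ _ (measurableTypeR R) (measurableTypeR R) R mu mu
    (fun z => G z.2 * (tpow al (z.2 - z.1) * tpow 2^-1 z.1)%:E)); last 2 first.
  - exact: measurable_conv_tpow.
  - by move=> z; rewrite mule_ge0// lee_fin mulr_ge0 ?tpow_ge0.
  rewrite -ge0_integralZl//; last 2 first.
  - apply: emeasurable_funM => //.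
    by apply/measurable_EFinP; exact: measurable_tpow.
  - by move=> t _; rewrite mule_ge0// lee_fin tpow_ge0.
  apply: eq_integral => t _ /=; rewrite ge0_integralZl//; last 2 first.
  - apply/measurable_EFinP; apply: measurable_funM; last exact: measurable_tpow.
    by apply: (measurableT_comp (measurable_tpow al)); exact: measurable_funB.
  - by move=> s _; rewrite lee_fin mulr_ge0 ?tpow_ge0.
  by rewrite conv_tpow -/B -alE muleCA.
have mI : measurable_fun setT (fun t : R => (\1_[set t : R | t < 1]%R t)%:E : \bar R).
  apply/measurable_EFinP; apply: measurable_indic.
  have -> : [set t : R | (t < 1)%R] = `]-oo, 1%R[%classic; last by [].
  by apply/seteqP; split => x /=; rewrite in_itv.
have I0 t : 0 <= (\1_[set t : R | t < 1]%R t)%:E :> \bar R by rewrite lee_fin.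
(* Tested on the indicator of [t < 1], the formula gives the volume of the unit ball. As this is
   positive and finite, [B] is neither 0 nor infinite. *)
have H1 := iint_ball_gt0 m.+1; have H2 := iint_ball_lty m.+1.
rewrite (key _ mI I0) in H1 H2.
have Bfin : B \is a fin_num.
  rewrite ge0_fin_numE// ltey; apply/negP => /eqP By.
  move: H1 H2; rewrite By; set I := \int[mu]_t _.
  have : 0 <= I by apply: integral_ge0 => t _; rewrite mule_ge0// lee_fin tpow_ge0.
  rewrite le_eqVlt => /predU1P[<-|I1]; first by rewrite !mule0 ltxx.
  by rewrite gt0_mulye// gt0_muley ?lte_fin// ltxx.
have Bpos : (0 < fine B)%R.
  rewrite -lte_fin fineK// lt_def B0 andbT; apply/negP => /eqP Bz.
  by move: H1; rewrite Bz mul0e mule0 ltxx.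
exists (c * fine B)%R; split; first exact: mulr_gt0.
by move=> G mG G0; rewrite key// EFinM fineK// muleA.
Qed.

End polar.

(** * Power integrals and the weak-type argument *)

Section power_integral.
Local Open Scope ereal_scope.
Variable R : realType.
Local Notation mu := (@lebesgue_measure R).

Lemma integral_powR_itv_le (al e B : R) : (0 < al)%R -> (0 < e)%R -> (0 < B)%R ->
  \int[mu]_(t in `[e, B]) (t `^ (al - 1))%:E <= (B `^ al / al)%:E.
Proof.
move=> al0 e0 B0; have [eB|Be] := ltP e B; last first.
  have -> : \int[mu]_(t in `[e, B]) (t `^ (al - 1))%:E = 0.
    apply: (@integral_Sset1 _ _ _ e) => x /=; rewrite in_itv/= => /andP[ex xB].
    by apply/eqP; rewrite eq_le (le_trans xB Be) ex.
  by rewrite lee_fin divr_ge0 ?powR_ge0 ?ltW.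
have pos x : x \in `]e, B[ -> (0 < x)%R by rewrite in_itv/= => /andP[/(lt_trans e0)].
have dF (x : R) : (0 < x)%R -> is_derive x (1%R : R) (fun t => t `^ al / al)%R (x `^ (al - 1))%R.
  move=> x0; have xi : x \in `]0%R, +oo[ by rewrite in_itv/= x0.
  have ? : is_derive x (1%R : R) (fun t => t `^ al)%R (al * x `^ (al - 1))%R.
    split; first exact: derivable_powR.
    by rewrite -derive1E (powR_derive1 al).
  apply: is_derive_eq; rewrite /GRing.scale/= ?mulr0 ?add0r ?addr0.
  by rewrite mulrA mulVf ?mul1r// gt_eqF.
have cp (be x : R) : (0 < x)%R -> {for x, continuous (fun t => t `^ be)%R}.
  move=> x0; apply/differentiable_continuous/derivable1_diffP.
  by apply: derivable_powR; rewrite in_itv/= x0.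
have cF (x : R) : (0 < x)%R -> {for x, continuous (fun t => t `^ al / al)%R}.
  move=> x0; apply/differentiable_continuous/derivable1_diffP.
  by have [] := dF x x0.
rewrite (@continuous_FTC2 _ (fun t => t `^ (al - 1))%R (fun t => t `^ al / al)%R)//.
- by rewrite -EFinB lee_fin gerBl divr_ge0 ?powR_ge0 ?ltW.
- apply: continuous_in_subspaceT => x /[!inE]/=; rewrite in_itv/= => /andP[ex _].
  exact/cp/(lt_le_trans e0).
- split.
  + by move=> x /pos x0; have [] := dF x x0.
  + exact/cvg_at_right_filter/cF.
  + exact/cvg_at_left_filter/cF.
- by move=> x /pos x0; rewrite derive1E; have [_ ->] := dF x x0.
Qed.

Lemma integral_tpow_le (al B : R) : (0 < al)%R -> (0 < B)%R ->
  \int[mu]_t (\1_[set t | t < B]%R t * tpow al t)%:E <= (B `^ al / al)%:E.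
Proof.
(* The integrand is singular at 0 when [al < 1]; the intervals [[1/(n+1), B]] stay away from 0 and
   exhaust []0, B]]. *)
move=> al0 B0; pose F (n : nat) : set (measurableTypeR R) := `[n.+1%:R^-1%R, B]%classic.
have FE : \bigcup_n F n = `]0%R, B]%classic.
  apply/seteqP; split => x /=.
    move=> [n _]; rewrite /F/= !in_itv/= => /andP[nx ->]; rewrite andbT.
    by apply: lt_le_trans nx; rewrite invr_gt0.
  rewrite in_itv/= => /andP[x0 xB]; have [n nx] : exists n, (x^-1 < n%:R)%R.
    by exists (Num.bound x^-1)%R; rewrite archi_boundP// invr_ge0 ltW.
  exists n => //; rewrite /F/= in_itv/= xB andbT -[leRHS]invrK lef_pV2 ?posrE ?invr_gt0//.
  by rewrite ltW// (lt_le_trans nx)// ler_nat.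
apply: (@le_trans _ _ (\int[mu]_(t in `]0%R, B]) (t `^ (al - 1))%:E)).
  rewrite [leRHS]integral_mkcond; apply: le_integral_unmeasured => t _.
    by rewrite lee_fin mulr_ge0 ?tpow_ge0.
  rewrite patchE; case: ifPn => [_|].
    rewrite lee_fin indicE /tpow; case: ifP => t0; last by rewrite mulr0 powR_ge0.
    by case: (t \in _); rewrite ?mul1r// mul0r powR_ge0.
  rewrite lee_fin notin_setE/= in_itv/= => h; rewrite /tpow.
  case: ifP => t0; rewrite ?mulr0// indicE memNset ?mul0r//= => tB.
  by apply: h; rewrite t0 ltW.
rewrite -FE.
have ndF : nondecreasing_seq F.
  move=> m n mn; apply/subsetPset => x; rewrite /F/= !in_itv/= => /andP[h ->].
  by rewrite andbT (le_trans _ h)// lef_pV2 ?posrE// ler_nat ltnS.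
have mF i : measurable (F i) by exact: measurable_itv.
have mf i : measurable_fun (F i) (fun t => (t `^ (al - 1))%:E).
  by apply/measurable_EFinP; apply: measurable_funTS; exact: measurable_powR.
have f0 i x : F i x -> 0 <= (x `^ (al - 1))%:E by rewrite lee_fin powR_ge0.
have <- := cvg_lim _ (@ge0_nondecreasing_set_cvg_integral _ _ R F _ mu ndF mF mf f0) => //.
apply: lime_le.
  apply: ereal_nondecreasing_is_cvgn.
  exact: ge0_nondecreasing_set_nondecreasing_integral.
by apply: nearW => n; apply: integral_powR_itv_le; rewrite // invr_gt0.
Qed.

End power_integral.

Section weak_type.
Local Open Scope ereal_scope.
Context d (T : measurableType d) (R : realType).
Variable mu : {measure set T -> \bar R}.

Lemma weak_type_bound (p K : R) (E : set T) (n phi : T -> R) :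
  (1 < p)%R -> (0 <= K)%R -> measurable E ->
  measurable_fun setT n -> measurable_fun setT phi ->
  (forall t, 0 <= n t)%R -> (forall t, 0 <= phi t)%R ->
  (forall la : R, (0 < la)%R ->
     \int[mu]_t (\1_[set t | phi t < la]%R t * n t)%:E <= (K * la)%:E) ->
  \int[mu]_t (\1_E t * n t)%:E <= (K + 1)%:E *
    poweR (\int[mu]_t (\1_E t * (phi t `^ (p - 1) * n t))%:E) p^-1.
Proof.
move=> p1 K0 mE mn mphi n0 phi0 weak.
have p0 : (0 < p)%R by lra.
set J := \int[mu]_t (\1_E t * (_ * _))%:E.
have J0 : 0 <= J.
  by apply: integral_ge0 => t _; rewrite lee_fin !mulr_ge0// powR_ge0.
have mEn : measurable_fun setT (fun t => \1_E t * (phi t `^ (p - 1) * n t))%R.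
  apply: measurable_funM => //; apply: measurable_funM => //.
  exact: (measurableT_comp (measurable_powR (p - 1)%R)).
(* Where [phi >= la] the factor [(phi / la)^(p-1)] is at least 1; the rest is covered by the
   weak-type hypothesis. *)
have bound (la : R) : (0 < la)%R ->
    \int[mu]_t (\1_E t * n t)%:E <= (K * la)%:E + (la `^ (1 - p))%:E * J.
  move=> la0; apply: (@le_trans _ _ (\int[mu]_t
    ((\1_[set t | phi t < la]%R t * n t)%:E +
     (la `^ (1 - p))%:E * (\1_E t * (phi t `^ (p - 1) * n t))%:E))).
    apply: le_integral_unmeasured => t _; first by rewrite lee_fin mulr_ge0.
    rewrite -EFinM -EFinD lee_fin; have [tla|tla] := ltP (phi t) la.
      rewrite [\1_[set _ | _] t]indicE mem_set//= mul1r.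
      apply: (@le_trans _ _ (n t)); last first.
        by rewrite lerDl !mulr_ge0 ?powR_ge0.
      by rewrite indicE; case: (t \in E); rewrite ?mul1r ?mul0r.
    apply: (@le_trans _ _ (la `^ (1 - p) * (\1_E t * (phi t `^ (p - 1) * n t)))%R); last first.
      by rewrite lerDr mulr_ge0.
    rewrite mulrCA ler_wpM2l// mulrA ler_peMl//.
    rewrite -(opprB p) powRN ler_pdivlMl ?powR_gt0// mulr1.
    by apply: ge0_ler_powR => //; rewrite ?nnegrE ?subr_ge0 ltW// (lt_le_trans la0 tla).
  have mla : measurable_fun setT (fun t => \1_[set t | phi t < la]%R t * n t)%R.
    apply: measurable_funM => //; apply: measurable_indic.
    rewrite -[X in measurable X]setTI; exact: (measurable_fun_ltr mphi (measurable_cst la)).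
  rewrite ge0_integralD//; last 4 first.
  - by move=> t _; rewrite lee_fin mulr_ge0.
  - exact/measurable_EFinP.
  - by move=> t _; rewrite mule_ge0 ?lee_fin ?powR_ge0// !mulr_ge0 ?powR_ge0.
  - by apply: measurable_funeM; exact/measurable_EFinP.
  rewrite leeD ?weak// ge0_integralZl//.
  - exact/measurable_EFinP.
  - by move=> t _; rewrite lee_fin !mulr_ge0 ?powR_ge0.
  - by rewrite lee_fin powR_ge0.
move: J0 bound; case: J => [J| |]//.
- rewrite lee_fin le_eqVlt => /predU1P[<-|J0] bound.
    rewrite poweR0r ?invr_eq0 ?gt_eqF// mule0; apply/lee_addgt0Pr => e e0.
    (* For [J = 0] only [K la] is left, and [la] may be taken as small as desired. *)
    have Ke : (0 < e / (K + 1))%R by rewrite divr_gt0// ltr_wpDl.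
    apply: (le_trans (bound _ Ke)); rewrite mule0 adde0 add0e lee_fin.
    rewrite mulrCA; apply: ler_piMr; first exact: ltW.
    by rewrite ler_pdivrMr ?ltr_wpDl// mul1r lerDl.
  (* At [la = J^(1/p)] the two terms balance: both are multiples of [J^(1/p)]. *)
  have l0 : (0 < J `^ p^-1)%R by rewrite powR_gt0.
  apply: (le_trans (bound _ l0)).
  rewrite poweR_EFin -!EFinM -EFinD lee_fin mulrDl mul1r lerD2l.
  have Jn0 : J != 0%R by rewrite gt_eqF.
  rewrite -powRrM -{2}(powRr1 (ltW J0)) -powRD ?Jn0 ?implybT//.
  by rewrite (_ : p^-1 * (1 - p) + 1 = p^-1)%R//; field; rewrite gt_eqF.
- move=> _ _; rewrite poweRyr ?invr_eq0 ?gt_eqF// gt0_muley ?leey// lte_fin.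
  by rewrite ltr_wpDl.
Qed.

End weak_type.

(** * The one-dimensional inequality between plane and space densities *)

Section radial_inequality.
Local Open Scope ereal_scope.
Variable R : realType.
Local Notation mu := (@lebesgue_measure R).

(* With [t = sinh^2 d(0, .)]: the radial density of the volume of [H^k],
   [kap = k / 2], and that of the weighted volume of [H^n], [p * kap = (a1 + n) / 2],
   both up to a constant factor. *)
Definition plane_density (kap t : R) : R := ((1 + t) `^ (- 2^-1) * tpow kap t)%R.
Definition space_density (q a2 t : R) : R := (tpow q t * (1 + t) `^ ((a2 - 1) / 2))%R.

Lemma plane_density_ge0 kap t : (0 <= plane_density kap t)%R.
Proof. by rewrite mulr_ge0 ?powR_ge0 ?tpow_ge0. Qed.

Lemma space_density_ge0 q a2 t : (0 <= space_density q a2 t)%R.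
Proof. by rewrite mulr_ge0 ?powR_ge0 ?tpow_ge0. Qed.

Lemma measurable_powR1D (x : R) : measurable_fun setT (fun t : R => (1 + t) `^ x)%R.
Proof.
by apply: (measurableT_comp (measurable_powR x)); exact: measurable_funD.
Qed.

Lemma measurable_plane_density kap : measurable_fun setT (plane_density kap).
Proof.
apply: measurable_funM; [exact: measurable_powR1D|exact: measurable_tpow].
Qed.

Lemma measurable_space_density q a2 : measurable_fun setT (space_density q a2).
Proof.
apply: measurable_funM; [exact: measurable_tpow|exact: measurable_powR1D].
Qed.

Lemma ltr_powR_root (t c x : R) : (0 < t)%R -> (0 < c)%R -> (0 < x)%R ->
  (t `^ x < c)%R -> (t < c `^ x^-1)%R.
Proof.
move=> t0 c0 x0 h; rewrite -[ltLHS]powRr1 ?ltW// -(mulfV (lt0r_neq0 x0)) powRrM.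
by apply: gt0_ltr_powR; rewrite ?invr_gt0// ?nnegrE ?powR_ge0 ?ltW.
Qed.

(** Split at [t = 1]. Below, the sublevel set lies in [t < B1] and the density is at most
    [t^(kap-1)]. Above, it lies in [t < B2] and the density is at most [t^(kap-3/2) <= t^(be-1)].
    Each power integral is then linear in [la]. The bound [-1 < e] serves both to make [be] positive
    and to compare the last two powers. *)
Lemma plane_density_weak_type (kap e : R) : (2^-1 <= kap)%R -> (-1 < e)%R ->
  exists K : R, (0 <= K)%R /\ forall la : R, (0 < la)%R ->
  \int[mu]_t (\1_[set t | t `^ kap * (1 + t) `^ (e / 2) < la]%R t *
     plane_density kap t)%:E <= (K * la)%:E.
Proof.
move=> k2 e1.
(* Passing from [e] to [th = min e 0] only enlarges the sublevel set, and makes [(1+t)^(th/2)]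
   non-increasing in [t]. It is thus at least [2^(th/2)] for [t <= 1] and at least [(2t)^(th/2)] for
   [t > 1]; hence [c0] and [be]. *)
have [th [th0 the th1]] : exists th : R, [/\ (th <= 0), (th <= e) & (-1 < th)]%R.
  by exists (Num.min e 0%R); rewrite !ge_min !lexx orbT lt_min e1 ltrN10.
pose be := (kap + th / 2)%R.
have k0 : (0 < kap)%R by lra.
have be0 : (0 < be)%R by rewrite /be; lra.
pose c0 := (2 `^ (th / 2) : R)%R; have c00 : (0 < c0)%R by rewrite powR_gt0.
exists (c0^-1 * (kap^-1 + be^-1))%R; split.
  by rewrite mulr_ge0 ?addr_ge0 ?invr_ge0 ?ltW.
move=> la la0; pose la' := (la / c0)%R.
have la'0 : (0 < la')%R by rewrite divr_gt0.
pose B1 := (la' `^ kap^-1)%R; pose B2 := (la' `^ be^-1)%R.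
apply: (@le_trans _ _ (\int[mu]_t ((\1_[set t | t < B1]%R t * tpow kap t)%:E +
    (\1_[set t | t < B2]%R t * tpow be t)%:E))).
  apply: le_integral_unmeasured => t _.
    by rewrite lee_fin mulr_ge0 ?plane_density_ge0.
  rewrite -EFinD lee_fin; have [t0|t0] := leP t 0%R.
    by rewrite /plane_density /tpow ltNge t0/= !mulr0 addr0.
  have [tla|tla] := ltP (t `^ kap * (1 + t) `^ (e / 2))%R la; last first.
    rewrite [\1_[set _ | _ * _ < _]%R t]indicE memNset ?mul0r.
      by rewrite addr_ge0// mulr_ge0 ?tpow_ge0.
    by move=> /=; rewrite ltNge tla.
  rewrite [\1_[set _ | _ * _ < _]%R t]indicE mem_set// mul1r.
  have t1 : (1 <= 1 + t)%R by lra.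
  have the2 : ((1 + t) `^ (th / 2) <= (1 + t) `^ (e / 2))%R.
    by rewrite ler_powR// ler_pM2r.
  have flip (x y : R) : (0 < x)%R -> (x <= y)%R -> (y `^ (th / 2) <= x `^ (th / 2))%R.
    move=> x0 xy; have y0 := lt_le_trans x0 xy.
    rewrite -(opprK (th / 2)%R) !(powRN _ (- _)).
    rewrite lef_pV2 ?posrE ?powR_gt0//.
    by apply: ge0_ler_powR; rewrite ?nnegrE//; lra.
  have [tle|tgt] := leP t 1%R.
    rewrite [X in (_ <= X + _)%R](_ : _ = tpow kap t); last first.
      rewrite indicE mem_set ?mul1r//=; apply: ltr_powR_root => //.
      rewrite ltr_pdivlMr// (le_lt_trans _ tla)// ler_pM2l ?powR_gt0//.
      by apply: le_trans the2; apply: flip; lra.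
    apply: (@le_trans _ _ (tpow kap t)); last by rewrite lerDl mulr_ge0 ?tpow_ge0.
    rewrite /plane_density ler_piMl ?tpow_ge0// powRN invf_le1 ?powR_gt0//; last by lra.
    by rewrite -[leLHS](powRr0 (1 + t)%R) ler_powR// invr_ge0.
  have tbe : (t `^ be = t `^ kap * t `^ (th / 2))%R.
    by rewrite /be powRD// (gt_eqF t0) implybT.
  rewrite [X in (_ <= _ + X)%R](_ : _ = tpow be t); last first.
    rewrite indicE mem_set ?mul1r//=; apply: ltr_powR_root => //.
    rewrite ltr_pdivlMr// (le_lt_trans _ tla)// tbe -mulrA ler_pM2l ?powR_gt0//.
    apply: le_trans the2; rewrite mulrC -(powRM _ _ (ltW t0))//.
    by apply: flip; lra.
  apply: (@le_trans _ _ (tpow be t)); last by rewrite lerDr mulr_ge0 ?tpow_ge0.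
  rewrite /plane_density /tpow t0.
  apply: (@le_trans _ _ (t `^ (- 2^-1) * t `^ (kap - 1))%R).
    rewrite ler_wpM2r ?powR_ge0// !powRN lef_pV2 ?posrE ?powR_gt0//; last by lra.
    by apply: ge0_ler_powR; rewrite ?nnegrE ?invr_ge0//; lra.
  rewrite -powRD; last by rewrite (gt_eqF t0) implybT.
  by rewrite ler_powR ?ltW// /be; lra.
have mt (c x : R) : measurable_fun setT (fun t : R => (\1_[set t | t < c]%R t * tpow x t)%:E).
  apply/measurable_EFinP; apply: measurable_funM; last exact: measurable_tpow.
  apply: measurable_indic; have -> : [set t : R | (t < c)%R] = `]-oo, c[%classic; last by [].
  by apply/seteqP; split => y /=; rewrite in_itv.
rewrite ge0_integralD//; try by [exact: mt|move=> t _; rewrite lee_fin mulr_ge0 ?tpow_ge0].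
apply: (@le_trans _ _ ((B1 `^ kap / kap)%:E + (B2 `^ be / be)%:E)).
  by rewrite leeD// integral_tpow_le// powR_gt0.
rewrite -EFinD lee_fin /B1 /B2 -!powRrM !mulVf ?gt_eqF// (powRr1 (ltW la'0)).
by rewrite le_eqVlt; apply/orP; left; apply/eqP; rewrite /la'; field; rewrite !gt_eqF.
Qed.

Lemma plane_space_inequality (kap p a2 : R) : (2^-1 <= kap)%R ->
  (p = 1 /\ 0 <= a2 \/ 1 < p /\ 1 - p < a2)%R ->
  exists C : R, (0 < C)%R /\ forall E : set (measurableTypeR R), measurable E ->
  \int[mu]_t (\1_E t * plane_density kap t)%:E <=
  C%:E * poweR (\int[mu]_t (\1_E t * space_density (p * kap) a2 t)%:E) p^-1.
Proof.
move=> k2 [[-> a20]|[p1 pa2]].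
  exists 1%R; split=> // E mE; rewrite mul1e invr1 poweRe1; last first.
    by apply: integral_ge0 => t _; rewrite lee_fin mulr_ge0 ?space_density_ge0.
  apply: le_integral_unmeasured => t _; first by rewrite lee_fin mulr_ge0 ?plane_density_ge0.
  rewrite lee_fin ler_wpM2l// mul1r /plane_density /space_density mulrC.
  have [t0|t0] := ltP 0%R t; last by rewrite /tpow ltNge t0/= !mul0r.
  by rewrite ler_wpM2l ?tpow_ge0// ler_powR//; lra.
(* With this [e], the power [p - 1] of [t^kap (1+t)^(e/2)] times the plane density is exactly the
   space density, and [-1 < e] is [1 - p < a2]. *)
pose e := (a2 / (p - 1))%R.
have p10 : (0 < p - 1)%R by rewrite subr_gt0.
have e1 : (-1 < e)%R by rewrite ltr_pdivlMr//; lra.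
have [K [K0 weak]] := plane_density_weak_type k2 e1.
exists (K + 1)%R; split; first by rewrite ltr_wpDl.
move=> E mE.
have := @weak_type_bound _ (measurableTypeR R) R mu p K E (plane_density kap)
  (fun t => t `^ kap * (1 + t) `^ (e / 2))%R p1 K0 mE (measurable_plane_density kap).
move=> /(_ _ _ _ weak) H; apply: le_trans (H _ _ _) _.
- by apply: measurable_funM; [exact: measurable_powR|exact: measurable_powR1D].
- exact: plane_density_ge0.
- by move=> t; rewrite mulr_ge0 ?powR_ge0.
rewrite le_eqVlt; apply/orP; left; apply/eqP; congr (_ * poweR _ _).
apply: eq_integral => t _; congr (_ * _)%:E; rewrite /plane_density /space_density.
have [t0|t0] := ltP 0%R t; last by rewrite /tpow ltNge t0/= mul0r !mulr0.
have t1 : (0 < 1 + t)%R by lra.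
rewrite /tpow t0 powRM ?powR_ge0// -!powRrM.
rewrite (mulrC ((1 + t) `^ (- 2^-1))%R (t `^ (kap - 1))%R) mulrACA.
rewrite -!powRD ?(gt_eqF t0) ?(gt_eqF t1) ?implybT//.
congr (_ `^ _ * _ `^ _)%R; first by ring.
by rewrite /e; field; rewrite gt_eqF.
Qed.

(* Dilation by [A ^ 2] compares the plane at distance [arccosh A] from the
   origin with the planes through the origin; [1 <= p * kap] makes the
   dilation increase the density. *)
Lemma plane_space_inequality_dilated (kap p a2 : R) :
  (2^-1 <= kap)%R -> (1 <= p * kap)%R ->
  (p = 1 /\ 0 <= a2 \/ 1 < p /\ 1 - p < a2)%R ->
  exists C : R, (0 < C)%R /\ forall (A : R) (E : set (measurableTypeR R)),
  (1 <= A)%R -> measurable E ->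
  (A `^ ((2 * (p * kap) + a2 - 1) / p))%:E *
    \int[mu]_t (\1_E (A ^+ 2 * (1 + t) - 1)%R * plane_density kap t)%:E <=
  C%:E * poweR (\int[mu]_t (\1_E t * space_density (p * kap) a2 t)%:E) p^-1.
Proof.
move=> k2 pk pa.
have p0 : (0 < p)%R by case: pa => -[]; lra.
have [C [C0 HC]] := plane_space_inequality k2 pa.
exists C; split=> // A E A1 mE.
have A0 : (0 < A)%R by lra.
have A20 : (0 < A ^+ 2)%R by rewrite exprn_gt0.
have A21 : (1 <= A ^+ 2)%R by rewrite exprn_ege1.
pose E' : set (measurableTypeR R) := [set t | E (A ^+ 2 * (1 + t) - 1)%R].
have maff : measurable_fun setT (fun t : measurableTypeR R =>
    (A ^+ 2 * (1 + t) - 1)%R : measurableTypeR R).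
  by apply: measurable_funB => //; apply: measurable_funM => //; exact: measurable_funD.
have mE' : measurable E' by rewrite -[X in measurable X]setTI; exact: maff.
have EE' t : \1_E (A ^+ 2 * (1 + t) - 1)%R = \1_E' t :> R.
  by rewrite !indicE; congr (nat_of_bool _)%:R; apply/idP/idP; rewrite !inE.
set g := ((2 * (p * kap) + a2 - 1) / p)%R.
have mS (F : set (measurableTypeR R)) : measurable F ->
    measurable_fun setT (fun t : R => (\1_F t * space_density (p * kap) a2 t)%:E).
  move=> mF; apply/measurable_EFinP; apply: measurable_funM.
    exact: measurable_indic.
  exact: measurable_space_density.
have pos F t : 0 <= (\1_F t * space_density (p * kap) a2 t)%:E.
  by rewrite lee_fin mulr_ge0 ?space_density_ge0.
have dil : (A `^ (p * g))%:E * \int[mu]_t (\1_E' t * space_density (p * kap) a2 t)%:E <=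
    \int[mu]_t (\1_E t * space_density (p * kap) a2 t)%:E.
  rewrite (ge0_integral_affine (A ^+ 2 - 1)%R A20 (mS _ mE) (pos _)).
  have mcomp : measurable_fun setT (fun t : R =>
      (\1_E (A ^+ 2 * t + (A ^+ 2 - 1)) *
       space_density (p * kap) a2 (A ^+ 2 * t + (A ^+ 2 - 1)))%:E)%R.
    apply: (measurableT_comp (mS _ mE)).
    by apply: measurable_funD => //; exact: measurable_funM.
  rewrite -(ge0_integralZl mu measurableT (mS _ mE') (fun t _ => pos E' t));
    last by rewrite lee_fin powR_ge0.
  rewrite -(ge0_integralZl mu measurableT mcomp (fun t _ => pos E _));
    last by rewrite lee_fin ltW.
  apply: le_integral_unmeasured => t _; first by rewrite mule_ge0// lee_fin powR_ge0.
  rewrite -!EFinM lee_fin (_ : A ^+ 2 * t + (A ^+ 2 - 1) = A ^+ 2 * (1 + t) - 1)%R; last by ring.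
  rewrite EE' mulrCA [leRHS]mulrCA ler_wpM2l//.
  have [t0|t0] := leP t 0%R.
    rewrite {1}/space_density /tpow ltNge t0/= mul0r mulr0.
    by rewrite (mulr_ge0 (ltW A20))// space_density_ge0.
  have t1 : (0 < 1 + t)%R by lra.
  have s0 : (A ^+ 2 * t <= A ^+ 2 * (1 + t) - 1)%R by rewrite mulrDr; lra.
  have At0 : (0 < A ^+ 2 * t)%R by rewrite mulr_gt0.
  rewrite /space_density {2}/tpow (lt_le_trans At0 s0) (addrC 1%R (_ - 1)%R) subrK.
  rewrite (powRM _ (ltW A20) (ltW t1)) /tpow t0.
  (* The exponent count is [p g = 2 + 2 (p kap - 1) + (a2 - 1)]: the Jacobian, the power of [t], and
     the power of [1 + t]. The last scales exactly; the middle one only gains, since its exponent is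
     non-negative. *)
  have -> : (A `^ (p * g) = A ^+ 2 * ((A ^+ 2) `^ (p * kap - 1) * (A ^+ 2) `^ ((a2 - 1) / 2)))%R.
    rewrite -powRD ?(gt_eqF A20) ?implybT// -{1}(powRr1 (ltW A20)).
    rewrite -powRD ?(gt_eqF A20) ?implybT// -(powR_mulrn 2 (ltW A0)) -powRrM.
    by congr (_ `^ _)%R; rewrite /g; field; rewrite gt_eqF.
  rewrite -mulrA ler_pM2l// mulrACA ler_wpM2r ?mulr_ge0 ?powR_ge0//.
  rewrite -(powRM _ (ltW A20) (ltW t0)).
  by apply: ge0_ler_powR; rewrite ?nnegrE//; lra.
apply: (@le_trans _ _ ((A `^ g)%:E * (C%:E *
    poweR (\int[mu]_t (\1_E' t * space_density (p * kap) a2 t)%:E) p^-1))).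
  rewrite lee_wpmul2l ?lee_fin ?powR_ge0//.
  under eq_integral do rewrite EE'.
  exact: HC.
rewrite muleCA lee_wpmul2l ?lee_fin ?(ltW C0)//.
have -> : (A `^ g)%:E = poweR (A `^ (p * g))%:E p^-1.
  rewrite poweR_EFin -powRrM; congr (_ `^ _)%:E.
  by rewrite mulrC mulrA mulVf ?mul1r// gt_eqF.
have J0 : 0 <= \int[mu]_t (\1_E' t * space_density (p * kap) a2 t)%:E.
  exact: integral_ge0.
rewrite -poweRM ?lee_fin ?powR_ge0//.
apply: gt0_ler_poweR; rewrite ?invr_ge0 ?(ltW p0)//.
- by rewrite in_itv/= leey mule_ge0 ?lee_fin ?powR_ge0.
- by rewrite in_itv/= leey integral_ge0.
Qed.

End radial_inequality.

(** * Points of the hyperboloid and the distance of an embedded plane *)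

Section hyperboloid.
Variable R : realType.

Lemma minkE m (x y : 'I_m.+1 -> R) :
  mink x y = - (x ord0 * y ord0) + \sum_i x (lift ord0 i) * y (lift ord0 i).
Proof.
rewrite /mink; congr (_ + _); rewrite big_mkcond big_ord_recl eqxx/= add0r.
exact: eq_bigr.
Qed.

Lemma chart0 m (v : 'I_m -> R) : chart v ord0 = Num.sqrt (1 + sqnorm v).
Proof. by rewrite /chart unlift_none. Qed.

Lemma chartS m (v : 'I_m -> R) i : chart v (lift ord0 i) = v i.
Proof. by rewrite /chart liftK. Qed.

Lemma Hyp_chart m (v : 'I_m -> R) : @Hyp R m (chart v).
Proof.
have v0 : 0 < 1 + sqnorm v by rewrite ltr_pwDl// sqnorm_ge0.
split; last by rewrite chart0 sqrtr_gt0.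
rewrite minkE chart0 -expr2 sqr_sqrtr ?ltW//.
rewrite (eq_bigr (fun i => v i ^+ 2)); last by move=> i _; rewrite chartS expr2.
by rewrite -/(sqnorm v); ring.
Qed.

Lemma Hyp_chartE m (x : 'I_m.+1 -> R) :
  @Hyp R m x -> x = chart (fun i => x (lift ord0 i)).
Proof.
move=> [xx x0]; apply/funext => i; case: (unliftP ord0 i) => [j|] ->.
  by rewrite chartS.
rewrite chart0 -[LHS]gtr0_norm// -sqrtr_sqr; congr Num.sqrt.
move: xx; rewrite minkE /sqnorm expr2.
rewrite (eq_bigr (fun i => x (lift ord0 i) ^+ 2)); last by move=> j _; rewrite expr2.
by move=> h; lra.
Qed.

Lemma Hyp_ge1 m (x : 'I_m.+1 -> R) : @Hyp R m x -> 1 <= x ord0.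
Proof.
move=> /Hyp_chartE ->; rewrite chart0 -[leLHS]sqrtr1 ler_sqrt ?lerDl ?sqnorm_ge0//.
by rewrite addr_ge0 ?sqnorm_ge0.
Qed.

Lemma acoshR_arg_ge1 (u : R) : 1 <= u -> 1 <= u + Num.sqrt (u ^+ 2 - 1).
Proof. by move=> u1; rewrite (le_trans u1)// lerDl sqrtr_ge0. Qed.

Lemma expR_acoshR (u : R) : 1 <= u -> expR (acoshR u) = u + Num.sqrt (u ^+ 2 - 1).
Proof.
move=> u1; rewrite lnK// posrE (lt_le_trans _ (acoshR_arg_ge1 u1))//.
Qed.

Lemma expRN_acoshR (u : R) : 1 <= u -> expR (- acoshR u) = u - Num.sqrt (u ^+ 2 - 1).
Proof.
move=> u1; rewrite expRN expR_acoshR//.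
have h := lt_le_trans ltr01 (acoshR_arg_ge1 u1).
apply/(mulfI (lt0r_neq0 h)); rewrite mulfV ?lt0r_neq0//.
set s := Num.sqrt _; have s2 : s ^+ 2 = u ^+ 2 - 1.
  by rewrite sqr_sqrtr// subr_ge0 exprn_ege1.
have -> : (u + s) * (u - s) = u ^+ 2 - s ^+ 2 by ring.
by rewrite s2; ring.
Qed.

Lemma acoshRK (u : R) : 1 <= u -> coshR (acoshR u) = u.
Proof. by move=> u1; rewrite /coshR expR_acoshR// expRN_acoshR//; field. Qed.

Lemma sinhR_acoshR (u : R) : 1 <= u -> sinhR (acoshR u) = Num.sqrt (u ^+ 2 - 1).
Proof. by move=> u1; rewrite /sinhR expR_acoshR// expRN_acoshR//; field. Qed.

Lemma ler_acoshR (u v : R) : 1 <= u -> u <= v -> acoshR u <= acoshR v.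
Proof.
move=> u1 uv; have v1 := le_trans u1 uv.
rewrite /acoshR ler_ln ?posrE ?(lt_le_trans ltr01 (acoshR_arg_ge1 _))//.
rewrite lerD// ler_sqrt ?lerD2r; last by rewrite subr_ge0 exprn_ege1.
by rewrite lerXn2r ?nnegrE//; lra.
Qed.

(* Reverse Cauchy-Schwarz, from [|l b + v|^2 >= 0] with [l = sqrt(1+|v|^2) / a]. *)
Lemma linear_form_Hyp_ge m (a : R) (b v : 'I_m -> R) : 0 < a -> sqnorm b < a ^+ 2 ->
  Num.sqrt (a ^+ 2 - sqnorm b) <= a * Num.sqrt (1 + sqnorm v) + \sum_i b i * v i.
Proof.
move=> a0 ba; set A := Num.sqrt _; set y := Num.sqrt _; set S := \sum_i _.
have y2 : y ^+ 2 = 1 + sqnorm v by rewrite sqr_sqrtr// addr_ge0 ?sqnorm_ge0.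
have y0 : 0 < y by rewrite sqrtr_gt0 ltr_pwDl// sqnorm_ge0.
have A2 : A ^+ 2 = a ^+ 2 - sqnorm b by rewrite sqr_sqrtr// subr_ge0 ltW.
have : 0 <= \sum_i (y * b i + a * v i) ^+ 2.
  by apply: sumr_ge0 => i _; exact: sqr_ge0.
have -> : \sum_i (y * b i + a * v i) ^+ 2 =
    y ^+ 2 * sqnorm b + (2 * a * y) * S + a ^+ 2 * sqnorm v.
  rewrite /sqnorm /S !mulr_sumr -!big_split/=.
  by apply: eq_bigr => i _; ring.
have -> : sqnorm b = a ^+ 2 - A ^+ 2 by rewrite A2; ring.
have -> : sqnorm v = y ^+ 2 - 1 by rewrite y2; ring.
move=> h; have : 0 <= (y * A - a) ^+ 2 by exact: sqr_ge0.
have ay : 0 < 2 * a * y by rewrite !mulr_gt0.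
move=> h2; rewrite -(ler_pM2l ay); nra.
Qed.

Variables (n k : nat) (L : 'I_n.+1 -> 'I_k.+1 -> R).

Lemma lapp0E (y : 'I_k.+1 -> R) : lapp L y ord0 =
  L ord0 ord0 * y ord0 + \sum_i L ord0 (lift ord0 i) * y (lift ord0 i).
Proof. by rewrite /lapp big_ord_recl. Qed.

(** The first row [(a, b)] of [L] is the height function of the plane, a linear form on [H^k]. Its
    Minkowski length [sqrt (a^2 - |b|^2)] is its minimum there, that is [cosh d(0, xi)]. *)
Definition plane_height : R :=
  Num.sqrt (L ord0 ord0 ^+ 2 - sqnorm (fun i => L ord0 (lift ord0 i))).

Lemma lapp_chart0 (v : 'I_k -> R) : lapp L (chart v) ord0 =
  L ord0 ord0 * Num.sqrt (1 + sqnorm v) + \sum_i L ord0 (lift ord0 i) * v i.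
Proof.
by rewrite lapp0E chart0; congr (_ + _); apply: eq_bigr => i _; rewrite chartS.
Qed.

Hypothesis HL : hyp_embedding L.

Lemma hyp_embedding_gt0 : 0 < L ord0 ord0.
Proof.
have := (HL.2 _ (Hyp_chart (fun=> 0))).2; rewrite lapp_chart0.
have -> : sqnorm (fun _ : 'I_k => 0 : R) = 0.
  by rewrite /sqnorm big1// => i _; rewrite expr0n.
by rewrite addr0 sqrtr1 mulr1 big1 ?addr0// => i _; rewrite mulr0.
Qed.

(** The point with chart coordinates [-b] is sent to height at least 1, which reads
    [1 + |b|^2 <= a sqrt (1 + |b|^2)]. *)
Lemma hyp_embedding_ge1 :
  1 <= L ord0 ord0 ^+ 2 - sqnorm (fun i => L ord0 (lift ord0 i)).
Proof.
set b := fun i => _; have a0 := hyp_embedding_gt0.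
have := Hyp_ge1 (HL.2 _ (Hyp_chart (fun i => - b i))); rewrite lapp_chart0.
have -> : sqnorm (fun i => - b i) = sqnorm b.
  by apply: eq_bigr => i _; rewrite sqrrN.
have -> : \sum_i L ord0 (lift ord0 i) * - b i = - sqnorm b.
  by rewrite -sumrN; apply: eq_bigr => i _; rewrite mulrN expr2.
have N0 := sqnorm_ge0 b.
set y := Num.sqrt _; have y2 : y ^+ 2 = 1 + sqnorm b by rewrite sqr_sqrtr// addr_ge0.
have y0 : 0 < y by rewrite sqrtr_gt0 ltr_pwDl.
move=> h; have : y <= L ord0 ord0 by rewrite -(ler_pM2r y0); lra.
by move=> h2; nra.
Qed.

Lemma plane_height_ge1 : 1 <= plane_height.
Proof.
by rewrite -[leLHS]sqrtr1 ler_sqrt ?hyp_embedding_ge1// (le_trans ler01)// hyp_embedding_ge1.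
Qed.

Lemma hyp_embedding_lt :
  sqnorm (fun i => L ord0 (lift ord0 i)) < L ord0 ord0 ^+ 2.
Proof. by have := hyp_embedding_ge1; lra. Qed.

Lemma dist0_set_embedding : dist0_set (lapp L @` @Hyp R k) = acoshR plane_height.
Proof.
have a0 := hyp_embedding_gt0; have ba := hyp_embedding_lt.
have A1 := plane_height_ge1; set A := plane_height.
have A0 : 0 < A by rewrite (lt_le_trans ltr01).
pose b i := L ord0 (lift ord0 i).
have A2 : A ^+ 2 = L ord0 ord0 ^+ 2 - sqnorm b by rewrite sqr_sqrtr// subr_ge0 ltW.
have lb : lbound (@dist0 R n @` (lapp L @` @Hyp R k)) (acoshR A).
  move=> _ [_ [y Hy <-] <-]; rewrite /dist0 ler_acoshR// (Hyp_chartE Hy) lapp_chart0.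
  exact: linear_form_Hyp_ge.
have att : (@dist0 R n @` (lapp L @` @Hyp R k)) (acoshR A).
  (* The equality case of the reverse Cauchy-Schwarz inequality: this point has height [a / A] in
     the model, and its image has height [(a^2 - |b|^2) / A = A]. *)
  exists (lapp L (chart (fun i => - b i / A))).
    by exists (chart (fun i => - b i / A)) => //; exact: Hyp_chart.
  rewrite /dist0 lapp_chart0; congr acoshR.
  have -> : sqnorm (fun i => - b i / A) = sqnorm b / A ^+ 2.
    by rewrite /sqnorm mulr_suml; apply: eq_bigr => i _; rewrite exprMn sqrrN exprVn.
  have -> : Num.sqrt (1 + sqnorm b / A ^+ 2) = L ord0 ord0 / A.
    have -> : 1 + sqnorm b / A ^+ 2 = (L ord0 ord0 / A) ^+ 2.
      rewrite exprMn exprVn (_ : sqnorm b = L ord0 ord0 ^+ 2 - A ^+ 2); last by rewrite A2; ring.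
      by field; rewrite gt_eqF.
    by rewrite sqrtr_sqr gtr0_norm// divr_gt0.
  have -> : \sum_i L ord0 (lift ord0 i) * (- b i / A) = - (sqnorm b / A).
    by rewrite /sqnorm mulr_suml -sumrN; apply: eq_bigr => i _; rewrite /b; ring.
  apply/(mulIf (lt0r_neq0 A0)); rewrite -expr2 A2.
  by field; rewrite gt_eqF.
apply/eqP; rewrite eq_le; apply/andP; split.
  by apply: ge_inf => //; exists (acoshR A).
by apply: lb_le_inf => //; exists (acoshR A).
Qed.

Lemma coshR_dist0_set : coshR (dist0_set (lapp L @` @Hyp R k)) = plane_height.
Proof. by rewrite dist0_set_embedding acoshRK// plane_height_ge1. Qed.

End hyperboloid.

(** * Radial integrals over planes and over the whole space *)

Section radial_formulas.
Local Open Scope ereal_scope.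
Variable R : realType.
Local Notation mu := (@lebesgue_measure R).

Lemma measurable_acoshR : measurable_fun setT (@acoshR R).
Proof.
apply: (measurableT_comp (@measurable_ln R)); apply: measurable_funD => //.
by apply: (measurableT_comp (@measurable_sqrtr R)); apply: measurable_funB.
Qed.

Lemma radial_profile n (f : ('I_n.+1 -> R) -> R) : radial f ->
  exists h : R -> R, measurable_fun setT h /\
    forall x, @Hyp R n x -> f x = h (x ord0).
Proof.
move=> [f0 [mf0 fE]]; exists (f0 \o @acoshR R); split; last by move=> x /fE.
exact: (measurableT_comp mf0 measurable_acoshR).
Qed.

Lemma measurable_sqrt1D : measurable_fun setT (fun t : R => Num.sqrt (1 + t))%R.
Proof. by apply: (measurableT_comp (@measurable_sqrtr R)); exact: measurable_funD. Qed.

(** The constant is chosen before [n], [L] and [f]; this uniformity over planes is what allows a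
    single constant in the estimate. *)
Lemma radon_abs_polar k : exists c : R, (0 < c)%R /\
  forall n (L : 'I_n.+1 -> 'I_k.+2 -> R) (f : ('I_n.+1 -> R) -> R) (h : R -> R),
  hyp_embedding L -> measurable_fun setT h ->
  (forall x, @Hyp R n x -> f x = h (x ord0)) ->
  iint (fun y : 'I_k.+1 -> R => (`|f (lapp L (chart y))| * vol_density y)%:E) =
  c%:E * \int[mu]_t (`|h (plane_height L * Num.sqrt (1 + t))| *
    plane_density (k.+1%:R / 2) t)%:E.
Proof.
have [c [c0 polar]] := @iint_polar R k.
exists c; split=> // n L f h HL mh fE.
pose G (u : R) : \bar R := (`|h u|)%:E.
have mG : measurable_fun setT G.
  by apply/measurable_EFinP; exact: (measurableT_comp _ mh).
have G0 u : 0 <= G u by rewrite lee_fin.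
transitivity (iint (fun v : 'I_k.+1 -> R =>
  G (L ord0 ord0 * Num.sqrt (1 + sqnorm v) +
     \sum_i L ord0 (lift ord0 i) * v i)%R * ((Num.sqrt (1 + sqnorm v))^-1)%:E)).
  apply: eq_iint => v; rewrite fE; last by apply: HL.2; exact: Hyp_chart.
  by rewrite lapp_chart0 EFinM.
rewrite iint_boost//; [|exact: hyp_embedding_gt0|exact: hyp_embedding_lt].
rewrite -/(plane_height L).
rewrite (polar (fun t => G (plane_height L * Num.sqrt (1 + t))%R *
  ((Num.sqrt (1 + t))^-1)%:E)).
- congr (_ * _); apply: eq_integral => t _; rewrite /G -!EFinM; congr (_%:E).
  rewrite -mulrA; congr (_ * _)%R; rewrite /plane_density.
  have [t0|t0] := leP t 0%R; first by rewrite /tpow ltNge t0/= !mulr0.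
  by rewrite powRN powR12_sqrt//; lra.
- apply: emeasurable_funM.
    apply: (measurableT_comp mG); apply: measurable_funM => //.
    exact: measurable_sqrt1D.
  by apply/measurable_EFinP; apply: measurable_invr_sqrt; exact: measurable_funD.
- by move=> t; rewrite mule_ge0// lee_fin invr_ge0 sqrtr_ge0.
Qed.

Lemma coshR_dist0_chart m (v : 'I_m -> R) :
  coshR (dist0 (chart v)) = Num.sqrt (1 + sqnorm v).
Proof. by rewrite /dist0 acoshRK ?chart0// -chart0; exact/Hyp_ge1/Hyp_chart. Qed.

Lemma sinhR_dist0_chart m (v : 'I_m -> R) :
  sinhR (dist0 (chart v)) = Num.sqrt (sqnorm v).
Proof.
rewrite /dist0 sinhR_acoshR; last exact/Hyp_ge1/Hyp_chart.
congr Num.sqrt; rewrite chart0 sqr_sqrtr; last by rewrite addr_ge0 ?sqnorm_ge0.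
by ring.
Qed.

Lemma mu_w_polar n : exists c : R, (0 < c)%R /\
  forall (a1 a2 : R) (S : set R), measurable S ->
  mu_w a1 a2 [set x : 'I_n.+2 -> R | @Hyp R n.+1 x /\ S (x ord0)] =
  c%:E * \int[mu]_t (\1_[set t : R | S (Num.sqrt (1 + t))%R] t *
    space_density ((a1 + n.+1%:R) / 2) a2 t)%:E.
Proof.
have [c [c0 polar]] := @iint_polar R n.
exists c; split=> // a1 a2 S mS.
set E := [set t : R | S (Num.sqrt (1 + t))%R].
have mE : measurable E.
  by rewrite -[X in measurable X]setTI; exact: measurable_sqrt1D.
rewrite /mu_w.
transitivity (iint (fun v : 'I_n.+1 -> R =>
  (\1_E (sqnorm v) * Num.sqrt (sqnorm v) `^ a1 * Num.sqrt (1 + sqnorm v) `^ a2 *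
    (Num.sqrt (1 + sqnorm v))^-1)%:E)).
  apply: eq_iint => v; rewrite sinhR_dist0_chart coshR_dist0_chart.
  congr (_ * _ * _ * _)%:E; rewrite !indicE; congr (nat_of_bool _)%:R.
  apply/idP/idP; rewrite !inE /E/= chart0; first by case.
  by move=> ?; split=> //; exact: Hyp_chart.
rewrite (polar (fun t => (\1_E t * Num.sqrt t `^ a1 * Num.sqrt (1 + t) `^ a2 *
    (Num.sqrt (1 + t))^-1)%:E)).
- congr (_ * _); apply: eq_integral => t _; rewrite -EFinM; congr (_%:E).
  rewrite /space_density.
  have [t0|t0] := leP t 0%R; first by rewrite /tpow ltNge t0/= !(mulr0, mul0r).
  have t1 : (0 < 1 + t)%R by lra.
  have e1 : (Num.sqrt (1 + t) `^ a2 * (Num.sqrt (1 + t))^-1 =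
      (1 + t) `^ ((a2 - 1) / 2))%R.
    rewrite -(powR12_sqrt (ltW t1)) -powRN -powRrM -powRD.
      by congr (_ `^ _)%R; field.
    by rewrite (gt_eqF t1) implybT.
  have e2 : (Num.sqrt t `^ a1 * tpow (n.+1%:R / 2) t =
      tpow ((a1 + n.+1%:R) / 2) t)%R.
    rewrite /tpow t0 -(powR12_sqrt (ltW t0)) -powRrM -powRD.
      by congr (_ `^ _)%R; field.
    by rewrite (gt_eqF t0) implybT.
  by rewrite -e1 -e2; ring.
- apply/measurable_EFinP; apply: measurable_funM; last first.
    by apply: measurable_invr_sqrt; exact: measurable_funD.
  apply: measurable_funM; last first.
    by apply: (measurableT_comp (measurable_powR a2)); exact: measurable_sqrt1D.
  apply: measurable_funM; first exact: measurable_indic.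
  exact: (measurableT_comp (measurable_powR a1) (@measurable_sqrtr R)).
- by move=> t; rewrite lee_fin !mulr_ge0 ?powR_ge0 ?invr_ge0 ?sqrtr_ge0.
Qed.

Lemma measurable_level (h w : R -> R) :
  measurable_fun setT h -> measurable_fun setT w ->
  measurable_fun setT (fun z : measurableTypeR R * measurableTypeR R =>
    (\1_[set t | z.1 < h t]%R z.2 * w z.2)%:E).
Proof.
move=> mh mw; apply/measurable_EFinP; apply: measurable_funM; last first.
  exact: (measurableT_comp mw).
rewrite (_ : (fun z => _) = \1_[set z : measurableTypeR R * measurableTypeR R |
    (z.1 < h z.2)%R]); last first.
  by apply/funext => z; rewrite !indicE; congr (nat_of_bool _)%:R; apply/idP/idP; rewrite !inE.
apply: measurable_indic; rewrite -[X in measurable X]setTI.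
have mhz : measurable_fun setT (fun z : measurableTypeR R * measurableTypeR R => h z.2).
  exact: (measurableT_comp mh).
have mz : measurable_fun setT
    (fun z : measurableTypeR R * measurableTypeR R => z.1 : R).
  exact: measurable_fst.
exact: (measurable_fun_ltr mz mhz).
Qed.

Lemma layer_cake (h w : R -> R) :
  measurable_fun setT h -> measurable_fun setT w ->
  (forall t, 0 <= h t)%R -> (forall t, 0 <= w t)%R ->
  \int[mu]_t (h t * w t)%:E =
  \int[mu]_(s in `[0%R, +oo[) \int[mu]_t (\1_[set t | s < h t]%R t * w t)%:E.
Proof.
move=> mh mw h0 w0.
pose I : set (measurableTypeR R) := `[0%R, +oo[%classic.
have mI : measurable_fun setT (fun z : measurableTypeR R * measurableTypeR R =>
    (\1_I z.1)%:E : \bar R).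
  apply/measurable_EFinP.
  exact: (measurableT_comp (@measurable_indic _ _ R setT I (measurable_itv _))).
rewrite [RHS]integral_mkcond.
transitivity (\int[mu]_s \int[mu]_t ((\1_I s)%:E * (\1_[set t | s < h t]%R t * w t)%:E)).
  rewrite (@fubini_tonelli _ _ (measurableTypeR R) (measurableTypeR R) R mu mu
    (fun z => (\1_I z.1)%:E * (\1_[set t | z.1 < h t]%R z.2 * w z.2)%:E)); last 2 first.
  - by apply: emeasurable_funM => //; exact: measurable_level.
  - by move=> z; rewrite mule_ge0 ?lee_fin ?mulr_ge0.
  apply: eq_integral => t _ /=.
  transitivity (\int[mu]_s ((w t)%:E * (\1_(`[0%R, h t[%classic : set (measurableTypeR R)) s)%:E)).
    rewrite ge0_integralZl ?lee_fin//; last first.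
      by apply/measurable_EFinP; exact: measurable_indic.
    rewrite integral_indic// setIT/= lebesgue_measure_itv/= lte_fin mulrC EFinM.
    congr (_ * _); case: ltP => ht; first by rewrite -EFinB subr0.
    by congr (_%:E); apply/eqP; rewrite eq_le ht h0.
  apply: eq_integral => s _; rewrite -!EFinM; congr (_%:E); rewrite mulrA [RHS]mulrC.
  congr (_ * _)%R; rewrite !indicE -natrM mulnb; congr (nat_of_bool _)%:R.
  apply/idP/idP; last first.
    move=> /andP[/set_mem sI /set_mem st]; apply: mem_set => /=.
    by move: sI; rewrite /I/= !in_itv/= andbT => ->.
  move=> /set_mem/=; rewrite in_itv/= => /andP[s0 st].
  by apply/andP; split; apply: mem_set => //; rewrite /I/= in_itv/= s0.
apply: eq_integral => s _; rewrite patchE /I; case: ifPn => sI.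
  by apply: eq_integral => t _; rewrite indicE sI mul1e.
by rewrite integral0_eq// => t _; rewrite indicE (negbTE sI) mul0e.
Qed.

End radial_formulas.

(** * Sufficiency: from level sets to functions *)

Section sufficiency.
Local Open Scope ereal_scope.
Variable R : realType.
Local Notation mu := (@lebesgue_measure R).

(** A bound valid for every plane leaves the exceptional set empty. The distance is read off any
    embedding [L] with the same image as [z], so the choice of [L] does not matter. *)
Lemma radon_estimateW n k (a1 a2 p gamma : R) :
  (exists C : R, forall (f : ('I_n.+1 -> R) -> R) (L : 'I_n.+1 -> 'I_k.+1 -> R),
    radial f -> hyp_embedding L ->
    (plane_height L `^ gamma)%:E * `|radon L f| <= C%:E * lorentz_norm a1 a2 p f) ->
  radon_estimate n k a1 a2 p gamma.
Proof.
move=> [C HC]; exists C => f rf _; exists set0; split; [|split].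
- by apply: sigma_algebra0; exact: smallest_sigma_algebra.
- move=> z [_ [L [HL [<- ]]]].
  rewrite (coshR_dist0_set HL) => lt.
  by have := HC f L rf HL; rewrite leNgt lt.
- rewrite -[RHS](iint0 R (n.+1 * k.+1)).
  by apply: eq_iint => v; rewrite indicE in_set0.
Qed.

(** The [L^{p,1}] norm is itself an integral over levels of [mu {|f| > s}^(1/p)], so the inequality
    for the level set at each [s] integrates in [s] without loss. *)
Lemma radon_estimate_sufficient n k (a1 a2 p gamma : R) :
  p = ((a1 + n.+1%:R) / k.+1%:R)%R -> (1 <= p * (k.+1%:R / 2))%R ->
  (p = 1 /\ 0 <= a2 \/ 1 < p /\ 1 - p < a2)%R ->
  (gamma <= (a1 + a2 + n.+1%:R - 1) / p)%R ->
  radon_estimate n.+1 k.+1 a1 a2 p gamma.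
Proof.
move=> pE pk pa gg; apply: radon_estimateW.
have p0 : (0 < p)%R by case: pa => -[]; lra.
pose kap : R := (k.+1%:R / 2)%R.
have kap2 : (2^-1 <= kap)%R by rewrite ler_peMl// ler1n.
have qE : ((a1 + n.+1%:R) / 2 = p * kap)%R.
  by rewrite pE /kap mulrA divfK// pnatr_eq0.
have [C1 [C10 key]] := plane_space_inequality_dilated kap2 pk pa.
have [ck [ck0 radonE]] := @radon_abs_polar R k.
have [cn [cn0 muE]] := @mu_w_polar R n.
pose D := (cn `^ (- p^-1))%R.
have D0 : (0 < D)%R by rewrite powR_gt0.
exists (ck * C1 * D / p)%R => f L rf HL.
have [h [mh fE]] := radial_profile rf.
set A := plane_height L; have A1 : (1 <= A)%R := plane_height_ge1 HL.
set g := ((a1 + a2 + n.+1%:R - 1) / p)%R in gg.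
have gE : g = ((2 * (p * kap) + a2 - 1) / p)%R by rewrite -qE /g; congr (_ / _)%R; field.
pose ah (u : R) := `|h u|%R.
have mah : measurable_fun setT ah by exact: (measurableT_comp _ mh).
pose E (s : R) : set (measurableTypeR R) := [set t | s < ah (Num.sqrt (1 + t))]%R.
have mah1 : measurable_fun setT (fun t : R => ah (Num.sqrt (1 + t)))%R.
  by apply: (measurableT_comp mah); exact: measurable_sqrt1D.
have mE s : measurable (E s).
  rewrite -[X in measurable X]setTI.
  exact: (measurable_fun_ltr (measurable_cst s) mah1).
pose I s := \int[mu]_t (\1_(E s) t * space_density (p * kap) a2 t)%:E.
have I0 s : 0 <= I s.
  by apply: integral_ge0 => t _; rewrite lee_fin mulr_ge0 ?space_density_ge0.
have mI : measurable_fun setT I.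
  apply: (@measurable_fun_fubini_tonelli_F _ _ (measurableTypeR R)
    (measurableTypeR R) R mu (fun z => (\1_(E z.1) z.2 * space_density (p * kap) a2 z.2)%:E)).
    by apply: (measurable_level mah1); exact: measurable_space_density.
  by move=> z; rewrite lee_fin mulr_ge0 ?space_density_ge0.
pose J s := \int[mu]_t (\1_(E s) (A ^+ 2 * (1 + t) - 1)%R * plane_density kap t)%:E.
have J0 s : 0 <= J s.
  by apply: integral_ge0 => t _; rewrite lee_fin mulr_ge0 ?plane_density_ge0.
(* A point of the plane at height [A sqrt (1+t)] has [sinh^2 d = A^2 (1+t) - 1], the dilated
   variable. *)
have JE s : J s = \int[mu]_t
    (\1_[set t | s < ah (A * Num.sqrt (1 + t))]%R t * plane_density kap t)%:E.
  apply: eq_integral => t _; congr (_ * _)%:E; rewrite !indicE; congr (nat_of_bool _)%:R.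
  have -> : (t \in [set t | s < ah (A * Num.sqrt (1 + t))]%R) =
      (A ^+ 2 * (1 + t) - 1 \in E s)%R; last by [].
  have eA : Num.sqrt (1 + (A ^+ 2 * (1 + t) - 1)) = (A * Num.sqrt (1 + t))%R.
    rewrite addrC subrK sqrtrM ?sqr_ge0// sqrtr_sqr ger0_norm//; lra.
  by apply/idP/idP; rewrite !inE /E/= eA.
have mA : measurable_fun setT (fun t : R => ah (A * Num.sqrt (1 + t)))%R.
  by apply: (measurableT_comp mah); apply: measurable_funM => //; exact: measurable_sqrt1D.
have mJ : measurable_fun setT J.
  rewrite (_ : J = fun s => \int[mu]_t (\1_[set t | s < ah (A * Num.sqrt (1 + t))]%R t *
    plane_density kap t)%:E); last exact/funext.
  apply: (@measurable_fun_fubini_tonelli_F _ _ (measurableTypeR R)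
    (measurableTypeR R) R mu (fun z =>
      (\1_[set t | z.1 < ah (A * Num.sqrt (1 + t))]%R z.2 *
       plane_density kap z.2)%:E)).
    by apply: (measurable_level mA); exact: measurable_plane_density.
  by move=> z; rewrite lee_fin mulr_ge0 ?plane_density_ge0.
have radonJ : `|radon L f| <= ck%:E * \int[mu]_(s in `[0%R, +oo[) J s.
  apply: (le_trans (le_abse_iint _)).
  rewrite [leLHS](_ : _ = iint (fun y : 'I_k.+1 -> R =>
      (`|f (lapp L (chart y))| * vol_density y)%:E)); last first.
    apply: eq_iint => v; rewrite abse_EFin normrM; congr (_ * _)%:E.
    by rewrite ger0_norm// invr_ge0 sqrtr_ge0.
  rewrite (radonE _ _ _ _ HL mh fE) (layer_cake mA (measurable_plane_density kap))//.
  - rewrite lee_wpmul2l ?lee_fin ?(ltW ck0)// le_eqVlt; apply/orP; left; apply/eqP.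
    by apply: eq_integral => s _; rewrite JE.
  - by move=> t; exact: normr_ge0.
  - exact: plane_density_ge0.
have muI s : mu_w a1 a2 [set x | @Hyp R n.+1 x /\ (s < `|f x|)%R] = cn%:E * I s.
  rewrite (_ : [set x | _] = [set x | @Hyp R n.+1 x /\ [set u | s < ah u]%R (x ord0)]); last first.
    by apply/seteqP; split=> x /= [Hx]; rewrite fE.
  rewrite muE ?qE//.
  rewrite -[X in measurable X]setTI; exact: (measurable_fun_ltr (measurable_cst s) mah).
(* [D] undoes the polar constant [cn] inside the power; likewise the [1 / p] in the final constant
   undoes the factor [p] of the Lorentz norm. *)
have IE s : poweR (I s) p^-1 = D%:E * poweR (cn%:E * I s) p^-1.
  rewrite poweRM// ?lee_fin ?(ltW cn0)// poweR_EFin muleA -EFinM /D.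
  by rewrite -powRD ?(gt_eqF cn0) ?implybT// addNr powRr0 mul1e.
have mpow : measurable_fun setT (fun s => poweR (cn%:E * I s) p^-1).
  apply: (measurableT_comp (@measurable_poweR R p^-1)).
  exact: measurable_funeM.
have ss : (A `^ gamma)%:E * `|radon L f| <=
    (A `^ g)%:E * (ck%:E * \int[mu]_(s in `[0%R, +oo[) J s).
  by rewrite lee_pmul// ?lee_fin ?powR_ge0// ler_powR.
apply: (le_trans ss).
rewrite muleCA -ge0_integralZl//; last 2 first.
- exact: measurable_funTS.
- by rewrite lee_fin powR_ge0.
apply: (@le_trans _ _ (ck%:E * \int[mu]_(s in `[0%R, +oo[)
    ((C1 * D)%:E * poweR (cn%:E * I s) p^-1))).
  rewrite lee_wpmul2l ?lee_fin ?(ltW ck0)//.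
  apply: le_integral_unmeasured => s _; first by rewrite mule_ge0 ?lee_fin ?powR_ge0.
  by rewrite EFinM -muleA -IE gE; exact: key.
rewrite ge0_integralZl//; last 3 first.
- exact: measurable_funTS.
- by move=> s _; rewrite poweR_ge0.
- by rewrite lee_fin mulr_ge0 ?ltW.
rewrite /lorentz_norm.
under [X in _ <= _ * (_ * X)]eq_integral do rewrite muI.
rewrite !muleA -!EFinM le_eqVlt; apply/orP; left; apply/eqP; congr (_%:E * _).
by field; rewrite gt_eqF.
Qed.

End sufficiency.

(** * Neighbourhoods in the space of frames *)

Section box_filter.
Variable R : realType.

(** The neighbourhood filter for the sup norm, described by boxes because a box has an explicit
    positive iterated integral; a negligible set therefore contains none. *)
Definition box_nbhs N (z0 : 'I_N -> R) : set_system ('I_N -> R) :=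
  [set P | exists2 e : R, 0 < e & forall z, (forall i, `|z i - z0 i| < e) -> P z].

#[global] Instance box_nbhs_filter N (z0 : 'I_N -> R) : ProperFilter (box_nbhs z0).
Proof.
split.
  by move=> [e e0 /(_ z0)]; apply => i; rewrite subrr normr0.
split.
- by exists 1.
- move=> P Q [e e0 eP] [d d0 dQ]; exists (Num.min e d); first by rewrite lt_min e0.
  move=> z zz; split; [apply: eP => i|apply: dQ => i].
    by have := zz i; rewrite lt_min => /andP[].
  by have := zz i; rewrite lt_min => /andP[].
- by move=> P Q PQ [e e0 eP]; exists e => // z /eP/PQ.
Qed.

Lemma cvg_box_nbhs N (z0 : 'I_N -> R) i : z i @[z --> box_nbhs z0] --> z0 i.
Proof.
apply/cvgrPdist_lt => e e0; exists e => // z /(_ i).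
by rewrite distrC.
Qed.

Lemma negligible_box_nbhs N (z0 : 'I_N -> R) (S : set ('I_N -> R)) :
  Defs.negligible S -> box_nbhs z0 S -> False.
Proof.
move=> [B [_ [SB B0]]] [e e0 eS].
have : (iint (fun x : 'I_N -> R =>
    (\1_[set x | forall i, (z0 i - e < x i < z0 i + e)%R] x)%:E) <=
    iint (fun x => (\1_B x)%:E))%E.
  apply: le_iint => v; first by rewrite lee_fin.
  rewrite lee_fin !indicE ler_nat; case: (boolP (v \in [set x | _])) => // /set_mem/= vi.
  rewrite mem_set//; apply/SB/eS => i.
  by rewrite ltr_norml ltrBlDl ltrBrDl; have := vi i; rewrite (addrC _ (- e)) (addrC _ e).
rewrite B0 iint_box; last by move=> i; lra.
rewrite lee_fin leNgt => /negP; apply; apply: prodr_gt0 => i _; lra.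
Qed.

Lemma cvg_bigsum T (F : set_system T) (FF : Filter F) (I : Type) (r : seq I)
    (P : pred I) (f : I -> T -> R) (l : I -> R) :
  (forall i, P i -> f i z @[z --> F] --> l i) ->
  \sum_(i <- r | P i) f i z @[z --> F] --> \sum_(i <- r | P i) l i.
Proof.
move=> fl; elim: r => [|i r IH].
  by rewrite big_nil; under eq_fun do rewrite big_nil; exact: cvg_cst.
rewrite big_cons; under eq_fun do rewrite big_cons.
by case: ifP => // Pi; apply: cvgD => //; exact: fl.
Qed.

End box_filter.

(** * Minkowski-orthonormal frames and the planes they span *)

Section minkowski.
Variable R : realType.

Definition msign m (i : 'I_m.+1) : R := if i == ord0 then -1 else 1.

Lemma msign2 m (i : 'I_m.+1) : msign i * msign i = 1.
Proof. by rewrite /msign; case: ifP => _; ring. Qed.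

Lemma mink_msign m (x y : 'I_m.+1 -> R) : mink x y = \sum_i msign i * (x i * y i).
Proof.
rewrite minkE big_ord_recl /msign eqxx mulN1r; congr (_ + _).
by apply: eq_bigr => i _; rewrite (eq_sym _ ord0) (negbTE (neq_lift _ _)) mul1r.
Qed.

Lemma minkC m (x y : 'I_m.+1 -> R) : mink x y = mink y x.
Proof. by rewrite !mink_msign; apply: eq_bigr => i _; rewrite (mulrC (x i)). Qed.

Lemma mink_suml m I (r : seq I) (P : pred I) (c : I -> R) (x : I -> 'I_m.+1 -> R) y :
  mink (fun a => \sum_(i <- r | P i) c i * x i a) y =
  \sum_(i <- r | P i) c i * mink (x i) y.
Proof.
rewrite mink_msign; under [RHS]eq_bigr do rewrite mink_msign mulr_sumr.
rewrite exchange_big/=; apply: eq_bigr => a _.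
rewrite mulr_suml mulr_sumr; apply: eq_bigr => i _; ring.
Qed.

Lemma minkBl m (x x' y : 'I_m.+1 -> R) :
  mink (fun a => x a - x' a) y = mink x y - mink x' y.
Proof. by rewrite !mink_msign -sumrB; apply: eq_bigr => i _; ring. Qed.

Lemma minkZl m (c : R) (x y : 'I_m.+1 -> R) :
  mink (fun a => x a * c) y = mink x y * c.
Proof. by rewrite !mink_msign mulr_suml; apply: eq_bigr => i _; ring. Qed.

Lemma cvg_mink T (F : set_system T) (FF : Filter F) m
    (x y : T -> 'I_m.+1 -> R) (x0 y0 : 'I_m.+1 -> R) :
  (forall a, x z a @[z --> F] --> x0 a) -> (forall a, y z a @[z --> F] --> y0 a) ->
  mink (x z) (y z) @[z --> F] --> mink x0 y0.
Proof.
move=> xc yc; rewrite mink_msign; under eq_fun do rewrite mink_msign.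
by apply: cvg_bigsum => a _; apply: cvgM; [exact: cvg_cst|exact: cvgM].
Qed.

Definition gram_orthonormal n k (L : 'I_n.+1 -> 'I_k.+1 -> R) :=
  forall i j, mink (L^~ i) (L^~ j) = msign i *+ (i == j).

Lemma mink_lapp n k (L : 'I_n.+1 -> 'I_k.+1 -> R) (y y' : 'I_k.+1 -> R) :
  gram_orthonormal L -> mink (lapp L y) (lapp L y') = mink y y'.
Proof.
move=> gL.
have lappE u : lapp L u = fun a => \sum_j u j * L a j.
  by apply/funext => a; apply: eq_bigr => j _; rewrite mulrC.
rewrite !lappE (mink_suml _ _ _ (fun j a => L a j)) mink_msign; apply: eq_bigr => i _.
rewrite minkC (mink_suml _ _ _ (fun j a => L a j)) (bigD1 i)//= big1 ?addr0.
  by rewrite gL eqxx mulr1n; ring.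
by move=> j ji; rewrite gL (negbTE ji) mulr0n mulr0.
Qed.

(** The Gram condition only preserves the form. The two strict inequalities single out the upper
    sheet, by the reverse Cauchy-Schwarz inequality, and they are open conditions, hence stable
    under small perturbations. *)
Lemma orthonormal_hyp_embedding n k (L : 'I_n.+1 -> 'I_k.+1 -> R) :
  gram_orthonormal L -> 0 < L ord0 ord0 ->
  sqnorm (fun i => L ord0 (lift ord0 i)) < L ord0 ord0 ^+ 2 ->
  hyp_embedding L.
Proof.
move=> gL a0 ba; split; first by move=> y z; exact: mink_lapp.
move=> y Hy; split; first by rewrite mink_lapp//; case: Hy.
rewrite (Hyp_chartE Hy) lapp_chart0; apply: lt_le_trans (linear_form_Hyp_ge _ a0 ba).
by rewrite sqrtr_gt0 subr_gt0.
Qed.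

Section orthonormalised_frame.
Variables (n k : nat) (z : 'I_(n.+1 * k.+1) -> R) (M : 'I_k.+1 -> 'I_k.+1 -> R).
Let L a i := \sum_l mx_of z a l * M l i.
Hypotheses (gL : gram_orthonormal L) (HL : hyp_embedding L).

Let lapp_factor y : lapp L y = lapp (mx_of z) (fun l => \sum_i M l i * y i).
Proof.
apply/funext => a; rewrite /lapp /L; under eq_bigr do rewrite mulr_suml.
rewrite exchange_big/=; apply: eq_bigr => l _; rewrite mulr_sumr.
by apply: eq_bigr => i _; ring.
Qed.

(** With [J] the Minkowski matrix, these are the rows of [J L^T J], a left inverse of [L] because
    [L^T J L = J]. *)
Let dual i a := msign i * (msign a * L a i).

(** The Gram condition says [Q M = 1] with [Q] the product of [dual] and [z]. Both matrices are
    square, so also [M Q = 1]: the columns of [z] are independent and have the same span as those of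
    [L]. *)
Let M_dual (c : 'I_k.+1 -> R) l :
  \sum_i M l i * (\sum_a dual i a * lapp (mx_of z) c a) = c l.
Proof.
pose Mm : 'M[R]_k.+1 := \matrix_(l, i) M l i.
pose Q : 'M[R]_k.+1 := \matrix_(i, l) \sum_a dual i a * mx_of z a l.
have QM : Q *m Mm = 1%:M.
  apply/matrixP => i j; rewrite !mxE.
  under eq_bigr do rewrite !mxE mulr_suml.
  rewrite exchange_big/=.
  transitivity (msign i * mink (L^~ i) (L^~ j)).
    rewrite mink_msign mulr_sumr; apply: eq_bigr => a _.
    rewrite /dual -[L a j]/(\sum_l mx_of z a l * M l j).
    have H (c' : R) : \sum_l msign i * (msign a * c') * mx_of z a l * M l j =
        msign i * (msign a * (c' * \sum_l mx_of z a l * M l j)).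
      by rewrite !mulr_sumr; apply: eq_bigr => l' _; rewrite !mulrA.
    exact: H.
  by rewrite gL mulrnAr msign2.
have /matrixP MQ := mulmx1C QM.
transitivity (\sum_l' (Mm *m Q) l l' * c l').
  under [RHS]eq_bigr do rewrite mxE mulr_suml.
  rewrite exchange_big/=; apply: eq_bigr => i _; rewrite !mxE.
  under [RHS]eq_bigr do rewrite mxE -mulrA.
  rewrite -mulr_sumr; congr (_ * _).
  under [RHS]eq_bigr do rewrite mulr_suml.
  rewrite exchange_big/=; apply: eq_bigr => a _; rewrite /lapp mulr_sumr.
  by apply: eq_bigr => l' _; rewrite mulrA.
rewrite (bigD1 l)//= big1 ?addr0 => [|l' l'l].
  by rewrite MQ mxE eqxx mul1r.
by rewrite MQ mxE eq_sym (negbTE l'l) mul0r.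
Qed.

Lemma frame_valid_param : valid_param z.
Proof.
split=> [c c0|].
  apply/funext => l; rewrite -(M_dual c l) c0.
  by rewrite big1// => i _; rewrite big1 ?mulr0// => a _; rewrite mulr0.
exists (lapp L (chart (fun=> 0))); split; first by apply: HL.2; exact: Hyp_chart.
by rewrite lapp_factor; eexists.
Qed.

Lemma frame_xi_of : lapp L @` @Hyp R k = xi_of z.
Proof.
apply/seteqP; split=> [_ [y Hy <-]|x [Hx [c xE]]].
  by split; [exact: HL.2|rewrite lapp_factor; eexists].
pose y i := \sum_a dual i a * lapp (mx_of z) c a.
have Ly : lapp L y = x.
  rewrite lapp_factor xE; congr lapp; apply/funext => l; exact: M_dual.
have yy : mink y y = -1 by rewrite -HL.1 Ly; case: Hx.
exists y => //; split=> //; rewrite ltNge; apply/negP => y0.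
have y0n : y ord0 != 0.
  apply/eqP => y00; move: yy; rewrite minkE y00 mul0r oppr0 add0r => yy.
  have : 0 <= \sum_i y (lift ord0 i) * y (lift ord0 i).
    by apply: sumr_ge0 => i _; rewrite -expr2 sqr_ge0.
  by rewrite yy; lra.
(* If [y] were on the lower sheet, [-y] would be on the upper one and be sent to [-x], whose height
   is negative. *)
have Ny : @Hyp R k (fun i => - y i).
  split; last by rewrite oppr_gt0 lt_neqAle y0n.
  by rewrite -yy !mink_msign; apply: eq_bigr => i _; rewrite mulrNN.
have := (HL.2 _ Ny).2; have -> : lapp L (fun i => - y i) ord0 = - x ord0.
  by rewrite -Ly /lapp -sumrN; apply: eq_bigr => j _; rewrite mulrN.
by case: Hx => _ x0; lra.
Qed.

End orthonormalised_frame.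

End minkowski.

(** * A plane at prescribed distance, and Gram-Schmidt near it *)

Section base_plane.
Variables (R : realType) (n k : nat) (kn : (k < n)%N) (A0 : R) (A1 : 1 < A0).
Let B0 := Num.sqrt (A0 ^+ 2 - 1).
Let up (i : 'I_k.+1) : 'I_n.+1 := widen_ord (leqW kn) i.
Let s (i : 'I_k.+1) : R := if i == ord0 then A0 else 1.
Let b (i : 'I_k.+1) : R := if i == ord0 then B0 else 0.

(* columns [A0 e_0 + B0 e_n, e_1, ..., e_k] *)
Definition base_plane (a : 'I_n.+1) (i : 'I_k.+1) : R :=
  s i * (a == up i)%:R + b i * (a == ord_max)%:R.

(** Since [k < n], the last axis is none of the axes carried by the plane, which leaves a direction
    in which to push it away from the origin. *)
Let up_max i : (up i == ord_max) = false.
Proof.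
by apply/negbTE; rewrite -val_eqE/= neq_ltn (leq_trans (ltn_ord i))//.
Qed.

Let up_eq i j : (up i == up j) = (i == j).
Proof. by rewrite -!val_eqE. Qed.

Let up0 : up ord0 = ord0. Proof. exact/val_inj. Qed.

Let msign_up i : msign R (up i) = msign R i.
Proof. by rewrite /msign -up0 up_eq. Qed.

Lemma base_plane_gram : gram_orthonormal base_plane.
Proof.
have sum_delta (g : 'I_n.+1 -> R) c : \sum_a g a * (a == c)%:R = g c.
  rewrite (bigD1 c)//= eqxx mulr1 big1 ?addr0// => a /negbTE ->; exact: mulr0.
move=> i j; rewrite mink_msign.
transitivity (\sum_a (msign R a * base_plane a i * s j) * (a == up j)%:R +
  \sum_a (msign R a * base_plane a i * b j) * (a == ord_max)%:R).
  rewrite -big_split/=; apply: eq_bigr => a _.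
  by rewrite {2}/base_plane; ring.
rewrite !sum_delta msign_up /base_plane up_eq up_max (eq_sym ord_max) up_max eqxx.
have -> : msign R (ord_max : 'I_n.+1) = 1.
  by rewrite /msign -val_eqE/= gtn_eqF// (leq_trans _ kn).
have B2 : B0 ^+ 2 = A0 ^+ 2 - 1 by rewrite sqr_sqrtr// subr_ge0 exprn_ege1// ltW.
rewrite /s /b /msign (eq_sym j i); case: (eqVneq i j) => [<-|ij].
  case: (i == ord0); rewrite ?mulr1n/=; last by ring.
  have -> : -1 * (A0 * 1 + B0 * 0) * A0 + 1 * (A0 * 0 + B0 * 1) * B0 =
    B0 ^+ 2 - A0 ^+ 2 by ring.
  by rewrite B2; ring.
case: (eqVneq i ord0) => [i0|_]; case: (eqVneq j ord0) => [j0|_]; rewrite ?mulr0n/=; try ring.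
by rewrite i0 j0 eqxx in ij.
Qed.

Lemma base_plane00 : base_plane ord0 ord0 = A0.
Proof.
rewrite /base_plane up0 eqxx /s /b eqxx mulr1 -[X in X == ord_max]up0 up_max.
by rewrite mulr0 addr0.
Qed.

Lemma base_plane0S i : base_plane ord0 (lift ord0 i) = 0.
Proof.
rewrite /base_plane -[X in X == up _]up0 up_eq -[X in X == ord_max]up0 up_max.
by rewrite (negbTE (neq_lift _ _)) !mulr0 addr0.
Qed.

End base_plane.

Section gram_schmidt.
Variables (R : realType) (n k : nat) (L0 : 'I_n.+1 -> 'I_k.+1 -> R).
Hypothesis gL0 : gram_orthonormal L0.

Let z0 : 'I_(n.+1 * k.+1) -> R := fun c => mxvec (\matrix_(a, i) L0 a i) ord0 c.

Let mx_of_z0 a i : mx_of z0 a i = L0 a i.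
Proof. by rewrite /mx_of /z0 mxvecE mxE. Qed.

Let cvg_mx_of a i : mx_of z a i @[z --> box_nbhs z0] --> L0 a i.
Proof. by rewrite -mx_of_z0; exact: cvg_box_nbhs. Qed.

(** At [z0] the frame is already orthonormal, so near [z0] the projection coefficients are close to
    0 and the normalising factors close to 1: nothing degenerates, although the form is indefinite.
    The matrix [M z] is carried along to keep track of the span. *)
Lemma gram_schmidt (j : nat) : (j <= k.+1)%N ->
  exists M : ('I_(n.+1 * k.+1) -> R) -> 'I_k.+1 -> 'I_k.+1 -> R,
  let L z a i := \sum_l mx_of z a l * M z l i in
  (forall (i : 'I_k.+1) a, (i < j)%N -> L z a i @[z --> box_nbhs z0] --> L0 a i) /\
  (\forall z \near box_nbhs z0, forall i i' : 'I_k.+1, (i < j)%N -> (i' < j)%N ->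
    mink (L z ^~ i) (L z ^~ i') = msign R i *+ (i == i')).
Proof.
elim: j => [_|j IH jk].
  by exists (fun _ _ _ => 0); split => [//|]; near=> z.
have [M [Lc Lo]] := IH (ltnW jk); set L := fun z a i => \sum_l mx_of z a l * M z l i in Lc Lo.
pose jj : 'I_k.+1 := Ordinal jk.
(* The sign stands for the inverse of the square length of column [i], which is 1 or -1; it plays
   the same part under the root in [nrm], where it makes the timelike column positive. *)
pose q z i := msign R i * mink (mx_of z ^~ jj) (L z ^~ i).
pose w z a := mx_of z a jj - \sum_(i : 'I_k.+1 | (i < j)%N) q z i * L z a i.
pose nrm z := Num.sqrt (msign R jj * mink (w z) (w z)).
(* Column [jj] of [M'] holds the coordinates of [w z / nrm z] in the columns of [z]. *)
pose M' z l i := if i == jj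
  then ((l == jj)%:R - \sum_(i' : 'I_k.+1 | (i' < j)%N) q z i' * M z l i') / nrm z else M z l i.
exists M' => L'.
have L'jj z a : L' z a jj = w z a * (nrm z)^-1.
  rewrite /L' /M' eqxx /w mulrBl.
  under eq_bigr do rewrite mulrA mulrBr mulrBl.
  rewrite sumrB; congr (_ - _).
    rewrite (bigD1 jj)//= eqxx mulr1 big1 ?addr0// => l /negbTE ->.
    by rewrite mulr0 mul0r.
  rewrite mulr_suml; under eq_bigr do rewrite mulr_sumr mulr_suml.
  rewrite exchange_big/=; apply: eq_bigr => i _; rewrite /L mulr_sumr mulr_suml.
  by apply: eq_bigr => l _; ring.
have L'E z a i : i != jj -> L' z a i = L z a i.
  by move=> ij; apply: eq_bigr => l _; rewrite /M' (negbTE ij).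
have ltjj (i : 'I_k.+1) : (i < j)%N -> i != jj.
  by move=> ij; rewrite -val_eqE/= ltn_eqF.
have qc (i : 'I_k.+1) : (i < j)%N -> q z i @[z --> box_nbhs z0] --> (0 : R).
  move=> ij; rewrite -[X in _ --> X](mulr0 (msign R i)); apply: cvgM; first exact: cvg_cst.
  have <- : mink (L0 ^~ jj) (L0 ^~ i) = 0.
    by rewrite gL0 eq_sym (negbTE (ltjj _ ij)).
  by apply: cvg_mink => a; [exact: cvg_mx_of|exact: Lc].
have wc a : w z a @[z --> box_nbhs z0] --> L0 a jj.
  rewrite -[X in _ --> X]subr0; apply: cvgB; first exact: cvg_mx_of.
  rewrite [X in _ --> X](_ : _ = \sum_(i : 'I_k.+1 | (i < j)%N) 0 * L0 a i).
    by apply: cvg_bigsum => i ij; apply: cvgM; [exact: qc|exact: Lc].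
  by rewrite big1// => i _; rewrite mul0r.
have wwc : msign R jj * mink (w z) (w z) @[z --> box_nbhs z0] --> (1 : R).
  rewrite -[X in _ --> X](msign2 R jj); apply: cvgM; first exact: cvg_cst.
  rewrite [X in _ --> X](_ : _ = mink (L0 ^~ jj) (L0 ^~ jj)).
    by apply: cvg_mink.
  by rewrite gL0 eqxx mulr1n.
have nc : nrm z @[z --> box_nbhs z0] --> (1 : R).
  by rewrite -[X in _ --> X]sqrtr1; apply: continuous_cvg => //; exact: sqrt_continuous.
split.
  move=> i a; rewrite ltnS leq_eqVlt => /orP[/eqP ij|ij]; last first.
    by under eq_fun do rewrite L'E ?ltjj//; exact: Lc.
  have -> : i = jj by exact/val_inj.
  under eq_fun do rewrite L'jj.
  have := cvgM (wc a) (cvgV (oner_neq0 _) nc).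
  by rewrite invr1 mulr1; apply.
have wpos : \forall z \near box_nbhs z0, 0 < msign R jj * mink (w z) (w z).
  exact: cvgr_gt wwc _ ltr01.
near=> z.
have Loz : forall i i' : 'I_k.+1, (i < j)%N -> (i' < j)%N ->
    mink (L z ^~ i) (L z ^~ i') = msign R i *+ (i == i') by near: z.
have wz : 0 < msign R jj * mink (w z) (w z) by near: z.
have nz2 : nrm z ^+ 2 = msign R jj * mink (w z) (w z) by rewrite sqr_sqrtr// ltW.
have nz0 : nrm z != 0 by rewrite sqrtr_eq0 -ltNge.
have wL (i : 'I_k.+1) : (i < j)%N -> mink (w z) (L z ^~ i) = 0.
  move=> ij; rewrite minkBl (mink_suml _ _ (q z) (fun i a => L z a i)).
  rewrite (bigD1 i)//= Loz// eqxx mulr1n big1 ?addr0 => [|i' /andP[i'j i'i]].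
    by rewrite /q mulrAC msign2 mul1r subrr.
  by rewrite Loz// (negbTE i'i) mulr0.
have colE (i : 'I_k.+1) : (i < j)%N -> L' z ^~ i = L z ^~ i.
  by move=> ij; apply/funext => a; rewrite L'E// ltjj.
have coljj : L' z ^~ jj = fun a => w z a * (nrm z)^-1.
  by apply/funext => a; rewrite L'jj.
have LS (i : 'I_k.+1) : (i < j.+1)%N -> i = jj \/ (i < j)%N.
  by rewrite ltnS leq_eqVlt => /orP[/eqP ij|ij]; [left; exact/val_inj|right].
move=> i i' /LS[->|ij] /LS[->|i'j].
- rewrite coljj minkZl minkC minkZl eqxx mulr1n.
  have -> : mink (w z) (w z) = msign R jj * nrm z ^+ 2 by rewrite nz2 mulrA msign2 mul1r.
  by field.
- by rewrite coljj colE// minkZl wL// mul0r eq_sym (negbTE (ltjj _ i'j)).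
- by rewrite coljj colE// minkC minkZl wL// mul0r (negbTE (ltjj _ ij)).
- by rewrite !colE// Loz.
Unshelve. all: by end_near. Qed.

End gram_schmidt.

(** The base plane of height [A0], the midpoint of [al] and [be], satisfies every condition
    required, and all of them are open after orthonormalisation. If no such [z] lay outside [S], a
    whole box around the base frame would lie in [S]. *)
Lemma nonnegligible_planes (R : realType) (n k : nat) (al be : R)
    (S : set ('I_(n.+1 * k.+1) -> R)) :
  (k < n)%N -> 1 <= al -> al < be -> Defs.negligible S ->
  exists z L, [/\ ~ S z, valid_param z, hyp_embedding L,
    lapp L @` @Hyp R k = xi_of z & al < plane_height L < be].
Proof.
move=> kn al1 albe nS; pose A0 := (al + be) / 2.
have A1 : 1 < A0 by rewrite /A0; lra.
have gL0 := base_plane_gram kn A1.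
have [M [/= Lc Lo]] := gram_schmidt gL0 (leqnn k.+1).
set z0 := fun c => _ in Lc Lo; set L := fun z a i => \sum_l mx_of z a l * M z l i.
have ac : L z ord0 ord0 @[z --> box_nbhs z0] --> A0.
  by rewrite -[X in _ --> X](base_plane00 kn A0); exact: Lc.
have dc : L z ord0 ord0 ^+ 2 - sqnorm (fun i => L z ord0 (lift ord0 i))
    @[z --> box_nbhs z0] --> A0 ^+ 2.
  rewrite -[X in _ --> X]subr0; apply: cvgB; first exact: cvgM.
  rewrite [X in _ --> X](_ : _ = \sum_(i < k) (0 : R) ^+ 2); last first.
    by rewrite big1// => i _; rewrite expr0n.
  apply: cvg_bigsum => i _.
  have h : L z ord0 (lift ord0 i) @[z --> box_nbhs z0] --> (0 : R).
    by rewrite -(base_plane0S kn A0 i); exact: Lc.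
  exact: (cvgM h h).
have hc : plane_height (L z) @[z --> box_nbhs z0] --> A0.
  rewrite [X in _ --> X](_ : A0 = Num.sqrt (A0 ^+ 2)).
    by apply: continuous_cvg => //; exact: sqrt_continuous.
  by rewrite sqrtr_sqr gtr0_norm//; lra.
apply: contrapT => H; apply: (negligible_box_nbhs nS (z0 := z0)).
have H1 : \forall z \near box_nbhs z0, 0 < L z ord0 ord0.
  by apply: cvgr_gt ac _ _; lra.
have H2 : \forall z \near box_nbhs z0,
    0 < L z ord0 ord0 ^+ 2 - sqnorm (fun i => L z ord0 (lift ord0 i)).
  by apply: cvgr_gt dc _ _; rewrite exprn_gt0//; lra.
have H3 : \forall z \near box_nbhs z0, al < plane_height (L z).
  by apply: cvgr_gt hc _ _; rewrite /A0; lra.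
have H4 : \forall z \near box_nbhs z0, plane_height (L z) < be.
  by apply: cvgr_lt hc _ _; rewrite /A0; lra.
suff : \forall z \near box_nbhs z0, S z by [].
near=> z; apply: contrapT => nSz; apply: H; exists z, (L z).
have gL : gram_orthonormal (L z).
  move=> i j; have : forall i i' : 'I_k.+1, (i < k.+1)%N -> (i' < k.+1)%N ->
    mink (L z ^~ i) (L z ^~ i') = msign R i *+ (i == i') by near: z.
  exact.
have HL : hyp_embedding (L z).
  apply: orthonormal_hyp_embedding => //; first by near: z.
  by rewrite -subr_gt0; near: z.
split=> //.
- exact: (frame_valid_param gL HL).
- exact: (frame_xi_of gL HL).
- by apply/andP; split; near: z.
Unshelve. all: by end_near. Qed.

(** * Necessity: indicators of shells *)

Section necessity.
Local Open Scope ereal_scope.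
Variable R : realType.
Local Notation mu := (@lebesgue_measure R).

(** One constant for exponents of either sign; with the roles of [X] and [t] exchanged it also
    supplies lower bounds. *)
Lemma powR_comparable (r X t : R) : (0 < X)%R -> (X / 2 <= t <= 3 * X)%R ->
  (t `^ r <= 3 `^ `|r| * X `^ r)%R.
Proof.
move=> X0 /andP[Xt tX]; have t0 : (0 < t)%R by lra.
have [r0|r0] := leP 0%R r.
  rewrite ger0_norm// -(powRM _ _ (ltW X0))//.
  by apply: ge0_ler_powR; rewrite ?nnegrE ?mulr_ge0//; lra.
rewrite -(opprK r) normrN !(powRN _ (- r)) ger0_norm ?oppr_ge0 ?(ltW r0)//.
rewrite ler_pdivlMr ?powR_gt0// mulrC ler_pdivrMr ?powR_gt0//.
rewrite -(powRM _ _ (ltW t0))//.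
by apply: ge0_ler_powR; rewrite ?nnegrE ?mulr_ge0//; lra.
Qed.

Lemma powR_unbounded (d C : R) : (0 < d)%R -> exists X : R, (4 <= X /\ C < X `^ d)%R.
Proof.
move=> d0; pose Y := (Num.max C 0 + 1 : R)%R.
have Y0 : (0 < Y)%R by rewrite ltr_wpDl// le_max lexx orbT.
exists (Num.max 4 (Y `^ d^-1))%R; split; first by rewrite le_max lexx.
apply: (@lt_le_trans _ _ Y).
  by rewrite (@le_lt_trans _ _ (Num.max C 0)%R) ?ltrDl// le_max lexx.
have YE : (Y = (Y `^ d^-1) `^ d)%R.
  by rewrite -powRrM mulVf ?gt_eqF// powRr1// ltW.
rewrite [leLHS]YE.
apply: ge0_ler_powR.
- exact: ltW.
- by rewrite nnegrE powR_ge0.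
- by rewrite nnegrE le_max ler0n.
- by rewrite le_max lexx orbT.
Qed.

(** Here [u] stands for [cosh d]. The width [2 h] leaves a margin [h] above the planes with
    [A^2 < X + h], so that they meet the shell in a set of controlled size. *)
Definition shell (X h : R) : set R := [set u | X < u ^+ 2 < X + 2 * h]%R.

Lemma measurable_shell X h : measurable (shell X h).
Proof.
rewrite (_ : shell X h = (fun u : R => u ^+ 2)%R @^-1` `]X, (X + 2 * h)%R[%classic).
  rewrite -[X in measurable X]setTI.
  by apply: (measurable_funX 2 (@measurable_id _ _ setT)).
by apply/seteqP; split => u /=; rewrite in_itv.
Qed.

Definition shell_fun n (X h : R) (x : 'I_n.+1 -> R) : R := \1_(shell X h) (x ord0).

Lemma radial_shell_fun n X h : radial (@shell_fun n X h).
Proof.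
exists (fun d => \1_(shell X h) (coshR d)); split.
  have mS : measurable_fun setT (\1_(shell X h) : R -> R).
    by apply: measurable_indic; exact: measurable_shell.
  apply: (measurableT_comp mS).
  by apply: continuous_measurable_fun; exact: continuous_coshR.
by move=> x Hx; rewrite /dist0 acoshRK//; exact: Hyp_ge1.
Qed.

Lemma lorentz_norm_shell_fun n (a1 a2 p X h : R) : (0 < p)%R ->
  lorentz_norm a1 a2 p (@shell_fun n X h) =
  p%:E * poweR (mu_w a1 a2 [set x | @Hyp R n x /\ shell X h (x ord0)]) p^-1.
Proof.
move=> p0; rewrite /lorentz_norm; congr (_ * _).
set P := poweR _ _; rewrite [LHS]integral_mkcond.
transitivity (\int[mu]_s (P * (\1_(`[0%R, 1%R[%classic : set (measurableTypeR R)) s)%:E)).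
  apply: eq_integral => s _; rewrite patchE indicE.
  have -> : (s \in `[0%R, +oo[%classic) = (0 <= s)%R by rewrite mem_setE in_itv/= andbT.
  have -> : (s \in `[0%R, 1%R[%classic) = (0 <= s < 1)%R by rewrite mem_setE in_itv.
  case: ifP => s0 /=; last by rewrite mule0.
  have [s1|s1] := ltP s 1%R.
    rewrite mule1; congr (poweR (mu_w _ _ _) _); apply/seteqP; split => x /= -[Hx].
      rewrite /shell_fun indicE; case: (boolP (_ \in _)) => [/set_mem//|_].
      by rewrite normr0 ltNge s0.
    by move=> xs; split=> //; rewrite /shell_fun indicE mem_set// normr1.
  rewrite mule0 (_ : mu_w _ _ _ = 0) ?poweR0r ?invr_eq0 ?gt_eqF//.
  rewrite /mu_w -[RHS](iint0 R n); apply: eq_iint => v; rewrite indicE memNset ?mul0r//= => -[_].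
  rewrite /shell_fun indicE ltNge; case: (_ \in _); rewrite ?normr1 ?normr0 ?s1//.
  by rewrite s0.
rewrite ge0_integralZl//; last 2 first.
- by apply/measurable_EFinP; exact: measurable_indic.
- exact: poweR_ge0.
by rewrite integral_indic// setIT/= lebesgue_measure_itv/= lte_fin ltr01 -EFinB subr0 mule1.
Qed.

(** In the variable [t] the shell has length [2 h], and there both [t] and [1 + t] are comparable to
    [X]: this is what [4 <= X] and [h <= X] ensure. *)
Lemma mu_w_shell n (a1 a2 q : R) : q = ((a1 + n.+1%:R) / 2)%R ->
  exists C : R, (0 < C)%R /\ forall X h : R, (4 <= X)%R -> (0 < h <= X)%R ->
  mu_w a1 a2 [set x | @Hyp R n.+1 x /\ shell X h (x ord0)] <=
  (C * (X `^ (q + (a2 - 1) / 2) * (h / X)))%:E.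
Proof.
move=> qE; have [c [c0 muE]] := @mu_w_polar R n.
pose K := (3 `^ `|q - 1| * 3 `^ `|(a2 - 1) / 2| : R)%R.
have K0 : (0 < K)%R by rewrite mulr_gt0 ?powR_gt0.
exists (c * (K * 2))%R; split; first by rewrite !mulr_gt0.
move=> X h X4 /andP[h0 hX]; have X0 : (0 < X)%R by lra.
rewrite muE; last exact: measurable_shell.
rewrite -qE -mulrA EFinM lee_wpmul2l ?lee_fin ?(ltW c0)//.
pose V := (K * (X `^ (q - 1) * X `^ ((a2 - 1) / 2)))%R.
have V0 : (0 <= V)%R by rewrite mulr_ge0 ?(ltW K0)// mulr_ge0 ?powR_ge0.
pose I : set (measurableTypeR R) := `](X - 1)%R, (X + 2 * h - 1)%R[%classic.
apply: (@le_trans _ _ (\int[mu]_t (V%:E * (\1_I t)%:E))).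
  apply: le_integral_unmeasured => t _; first by rewrite lee_fin mulr_ge0 ?space_density_ge0.
  rewrite -EFinM lee_fin [X in (X * _ <= _)%R]indicE.
  case: (boolP (t \in _)) => [/set_mem/=|_]; last by rewrite mul0r mulr_ge0.
  rewrite /shell/= mul1r => sh; have [t0|t0] := leP t 0%R.
    by rewrite /space_density /tpow ltNge t0/= mul0r mulr_ge0.
  move: sh; rewrite sqr_sqrtr; last by lra.
  move=> /andP[Xt tX]; rewrite indicE mem_set ?mulr1; last by rewrite /I/= in_itv/=; lra.
  rewrite /space_density /tpow t0 /V /K mulrACA.
  by apply: ler_pM; rewrite ?powR_ge0//; apply: powR_comparable => //; lra.
rewrite ge0_integralZl//; last first.
  by apply/measurable_EFinP; apply: measurable_indic; exact: measurable_itv.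
rewrite integral_indic//; last exact: measurable_itv.
rewrite setIT/= lebesgue_measure_itv/= lte_fin ifT; last by lra.
rewrite -EFinB -EFinM lee_fin /V le_eqVlt; apply/orP; left; apply/eqP.
have -> : (X `^ (q + (a2 - 1) / 2) = X * (X `^ (q - 1) * X `^ ((a2 - 1) / 2)))%R.
  rewrite -powRD ?(gt_eqF X0) ?implybT// -{2}(powRr1 (ltW X0)) -powRD ?(gt_eqF X0) ?implybT//.
  by congr (_ `^ _)%R; ring.
by field; rewrite gt_eqF.
Qed.

Lemma radon_shell_ge k : exists c : R, (0 < c)%R /\
  forall n (L : 'I_n.+1 -> 'I_k.+2 -> R) (X h : R), hyp_embedding L ->
  (4 <= X)%R -> (0 < h <= X)%R ->
  (Num.sqrt X < plane_height L < Num.sqrt (X + h))%R ->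
  (c * (h / X) `^ (k.+1%:R / 2))%:E <= `|radon L (shell_fun X h)|.
Proof.
have [c [c0 radonE]] := @radon_abs_polar R k.
set kap := (k.+1%:R / 2)%R in radonE *.
pose K := (3 `^ `|- 2^-1| * 3 `^ `|kap - 1| : R)%R.
have K0 : (0 < K)%R by rewrite mulr_gt0 ?powR_gt0.
exists (c * (K^-1 / 2 * 2 `^ (- kap)))%R; split.
  by rewrite !mulr_gt0 ?invr_gt0 ?powR_gt0.
move=> n L X h HL X4 /andP[h0 hX] /andP[XA AX]; have X0 : (0 < X)%R by lra.
set A := plane_height L in XA AX *.
have A1 : (1 <= A)%R := plane_height_ge1 HL.
have XA2 : (X < A ^+ 2)%R.
  by rewrite -(sqr_sqrtr (ltW X0)) ltr_pXn2r ?nnegrE ?sqrtr_ge0//; lra.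
have A2X : (A ^+ 2 < X + h)%R.
  have Xh : (0 <= X + h)%R by lra.
  by rewrite -(sqr_sqrtr Xh) ltr_pXn2r ?nnegrE ?sqrtr_ge0//; lra.
have mS : measurable_fun setT (\1_(shell X h) : R -> R).
  by apply: measurable_indic; exact: measurable_shell.
have : radon L (shell_fun X h) = c%:E * \int[mu]_t
    (`|\1_(shell X h) (A * Num.sqrt (1 + t)) : R| * plane_density kap t)%:E.
  rewrite -(radonE _ _ (@shell_fun n X h) _ HL mS)//.
  by apply: eq_iint => v; rewrite ger0_norm.
move=> ->; rewrite gee0_abs; last first.
  rewrite mule_ge0 ?lee_fin ?(ltW c0)// integral_ge0// => t _.
  by rewrite lee_fin mulr_ge0 ?plane_density_ge0.
rewrite -mulrA EFinM lee_wpmul2l ?lee_fin ?(ltW c0)//.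
(* As [A^2 < 2 X], for [t < et] one has [A^2 t < h], so the point stays in the shell. Keeping
   [t > et / 2] makes [t^(kap-1)] comparable to [et^(kap-1)] whatever the sign of [kap - 1], and
   gives an integral of order [et^kap]. *)
pose et := (h / X / 2)%R.
have et0 : (0 < et)%R by rewrite !divr_gt0.
have hX1 : (h / X <= 1)%R by rewrite ler_pdivrMr// mul1r.
have et2 : (et <= 2^-1)%R by rewrite ler_pdivrMr// mulVf.
have hE : (X * et = h / 2)%R by rewrite /et; field; rewrite gt_eqF.
pose I : set (measurableTypeR R) := `](et / 2)%R, et[%classic.
pose V := (K^-1 * et `^ (kap - 1))%R.
have V0 : (0 <= V)%R by rewrite mulr_ge0 ?powR_ge0 ?invr_ge0 ?ltW.
apply: (@le_trans _ _ (\int[mu]_t (V%:E * (\1_I t)%:E))); last first.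
  apply: le_integral_unmeasured => t _; first by rewrite mule_ge0 ?lee_fin.
  rewrite -EFinM lee_fin; rewrite [X in (_ * X <= _)%R]indicE.
  case: (boolP (t \in I)) => [/set_mem|_]; last first.
    by rewrite mulr0 mulr_ge0 ?plane_density_ge0.
  rewrite /I/= in_itv/= => /andP[tet ett]; have t0 : (0 < t)%R by lra.
  rewrite mulr1 indicE mem_set ?normr1 ?mul1r; last first.
    have t1 : (0 <= 1 + t)%R by lra.
    rewrite /shell/= exprMn (sqr_sqrtr t1).
    have At0 : (0 < A ^+ 2 * t)%R by rewrite mulr_gt0// exprn_gt0//; lra.
    have Ath : (A ^+ 2 * t < (X + X) * et)%R.
      by apply: ltr_pM; rewrite ?sqr_ge0 ?(ltW t0)//; lra.
    by rewrite mulrDr mulr1; apply/andP; split; lra.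
  rewrite /V /plane_density /tpow t0 ler_pdivrMl// mulrC.
  rewrite -[leLHS]mulr1 (mulrC _ 1%R) /K mulrACA [leRHS](_ : _ =
    3 `^ `|- 2^-1| * (1 + t) `^ (- 2^-1) * (3 `^ `|kap - 1| * t `^ (kap - 1)))%R; last by ring.
  apply: ler_pM; rewrite ?powR_ge0//; last by apply: powR_comparable => //; lra.
  have e1 : (1 = 1 `^ (- 2^-1) :> R)%R by rewrite powR1.
  rewrite [leLHS]e1.
  by apply: powR_comparable => //; lra.
rewrite ge0_integralZl//; last first.
  by apply/measurable_EFinP; apply: measurable_indic; exact: measurable_itv.
rewrite integral_indic//; last exact: measurable_itv.
rewrite setIT/= lebesgue_measure_itv/= lte_fin ifT; last by lra.
rewrite -EFinB -EFinM lee_fin /V le_eqVlt; apply/orP; left; apply/eqP.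
have etk : (et `^ kap = et * et `^ (kap - 1))%R.
  rewrite -{2}(powRr1 (ltW et0)) -powRD ?(gt_eqF et0) ?implybT//.
  by congr (_ `^ _)%R; ring.
have -> : ((h / X) `^ kap = 2 `^ kap * et `^ kap)%R.
  rewrite -(powRM _ _ (ltW et0))//; congr (_ `^ _)%R; rewrite /et; field.
  by rewrite gt_eqF.
rewrite etk powRN; have k20 : (2 `^ kap != 0 :> R)%R by rewrite gt_eqF ?powR_gt0.
by field; rewrite k20 gt_eqF.
Qed.

Lemma radon_estimate_shells n k (a1 a2 p gamma : R) : (k.+1 < n.+1)%N ->
  (0 < p)%R -> p = ((a1 + n.+1%:R) / k.+1%:R)%R ->
  radon_estimate n.+1 k.+1 a1 a2 p gamma ->
  exists C : R, (0 < C)%R /\ forall X r : R, (4 <= X)%R -> (0 < r <= 1)%R ->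
  (X `^ (gamma / 2) * r `^ (k.+1%:R / 2) <=
   C * (X `^ ((a1 + a2 + n.+1%:R - 1) / p / 2) * r `^ p^-1))%R.
Proof.
move=> kn p0 pE [C0 est].
have [Cm [Cm0 muE]] := mu_w_shell a2 (erefl ((a1 + n.+1%:R) / 2)%R).
have [cr [cr0 radE]] := @radon_shell_ge k.
pose K := (3 `^ `|gamma / 2| : R)%R; have K0 : (0 < K)%R by rewrite powR_gt0.
exists (K / cr * ((`|C0| + 1) * p * Cm `^ p^-1))%R; split.
  by rewrite !mulr_gt0 ?invr_gt0 ?powR_gt0// ltr_wpDl.
move=> X r X4 /andP[r0 r1]; pose h := (r * X)%R.
have X0 : (0 < X)%R by lra.
have hX : (0 < h <= X)%R by rewrite mulr_gt0//= ler_piMl// ltW.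
have hXE : (h / X = r)%R by rewrite /h mulfK// gt_eqF.
pose f := @shell_fun n.+1 X h.
set mS := mu_w a1 a2 [set x | @Hyp R n.+1 x /\ shell X h (x ord0)].
pose U := (Cm * (X `^ ((a1 + n.+1%:R) / 2 + (a2 - 1) / 2) * r))%R.
have U0 : (0 <= U)%R by rewrite !mulr_ge0 ?powR_ge0 ?ltW.
have mS0 : 0 <= mS.
  apply: iint_ge0 => v; rewrite lee_fin !mulr_ge0 ?powR_ge0//.
  by rewrite invr_ge0 sqrtr_ge0.
have mSU : mS <= U%:E by rewrite /U -hXE; exact: muE.
have nrm : lorentz_norm a1 a2 p f <= (p * U `^ p^-1)%:E.
  rewrite /f lorentz_norm_shell_fun// EFinM lee_wpmul2l ?lee_fin ?(ltW p0)//.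
  rewrite -poweR_EFin; apply: gt0_ler_poweR; rewrite ?invr_ge0 ?(ltW p0)//.
  - by rewrite in_itv/= leey mS0.
  - by rewrite in_itv/= leey lee_fin U0.
have nrm0 : 0 <= lorentz_norm a1 a2 p f.
  by rewrite mule_ge0 ?lee_fin ?(ltW p0)// integral_ge0// => s _; exact: poweR_ge0.
have inL : in_Lp1 a1 a2 p f by apply: le_lt_trans nrm _; rewrite ltry.
have neg := est f (radial_shell_fun _ _ _) inL.
have X1 : (1 <= Num.sqrt X)%R.
  by rewrite -[leLHS]sqrtr1 ler_sqrt ?ltW//; lra.
have XXh : (Num.sqrt X < Num.sqrt (X + h))%R.
  by rewrite ltr_sqrt ?ltrDl; case/andP: hX => *; lra.
have [z [L [nS vz HL LE Ah]]] := nonnegligible_planes kn X1 XXh neg.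
set A := plane_height L in Ah.
have A1 : (1 <= A)%R := plane_height_ge1 HL.
have main : (A `^ gamma)%:E * `|radon L f| <= C0%:E * lorentz_norm a1 a2 p f.
  rewrite leNgt; apply/negP => lt; apply: nS; split=> //; exists L.
  by rewrite -LE coshR_dist0_set.
(* Nothing fixes the sign of [C0], hence the positive substitute [|C0| + 1]. *)
have up : C0%:E * lorentz_norm a1 a2 p f <= ((`|C0| + 1) * (p * U `^ p^-1))%:E.
  apply: (@le_trans _ _ ((`|C0| + 1)%:E * lorentz_norm a1 a2 p f)).
    by rewrite lee_wpmul2r// lee_fin; have := ler_norm C0; lra.
  by rewrite [leRHS]EFinM lee_wpmul2l// lee_fin addr_ge0.
have low : (K^-1 * X `^ (gamma / 2) * (cr * r `^ (k.+1%:R / 2)))%:E <=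
    (A `^ gamma)%:E * `|radon L f|.
  rewrite EFinM lee_pmul ?lee_fin//.
  - by rewrite mulr_ge0 ?powR_ge0 ?invr_ge0 ?ltW.
  - by rewrite mulr_ge0 ?powR_ge0 ?ltW.
  (* The exponent [gamma] may be negative, but [X < A^2 < 2 X] makes the two powers comparable in
     either case. *)
  - rewrite ler_pdivrMl//.
    have A0 : (0 < A)%R by lra.
    have -> : (A `^ gamma = (A ^+ 2) `^ (gamma / 2))%R.
      by rewrite -(powR_mulrn 2 (ltW A0)) -powRrM; congr (_ `^ _)%R; field.
    apply: powR_comparable; first by rewrite exprn_gt0.
    case/andP: Ah => XA AX; case/andP: hX => h0 hX.
    have XA2 : (X < A ^+ 2)%R.
      by rewrite -(sqr_sqrtr (ltW X0)) ltr_pXn2r ?nnegrE ?sqrtr_ge0//; lra.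
    have A2X : (A ^+ 2 < X + h)%R.
      have Xh : (0 <= X + h)%R by lra.
      by rewrite -(sqr_sqrtr Xh) ltr_pXn2r ?nnegrE ?sqrtr_ge0//; lra.
    by apply/andP; split; lra.
  - by rewrite -hXE; exact: radE.
have := le_trans low (le_trans main up); rewrite lee_fin => H.
have UE : (U `^ p^-1 = Cm `^ p^-1 *
    (X `^ ((a1 + a2 + n.+1%:R - 1) / p / 2) * r `^ p^-1))%R.
  rewrite /U powRM ?(ltW Cm0)// ?mulr_ge0 ?powR_ge0 ?(ltW r0)//.
  rewrite powRM ?powR_ge0 ?(ltW r0)// -powRrM.
  by congr (_ * (_ `^ _ * _))%R; field; rewrite gt_eqF.
rewrite UE in H.
have := ler_wpM2l (ltW (mulr_gt0 K0 (_ : 0 < cr^-1)%R)) H.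
rewrite invr_gt0 => /(_ cr0).
rewrite [X in (X <= _)%R -> _](_ : _ = (X `^ (gamma / 2) * r `^ (k.+1%:R / 2))%R); last first.
  by field; rewrite !gt_eqF.
by move=> h'; apply: le_trans h' _; rewrite le_eqVlt; apply/orP; left; apply/eqP; ring.
Qed.

Lemma radon_estimate_gamma n k (a1 a2 p gamma : R) : (k.+1 < n.+1)%N ->
  (0 < p)%R -> p = ((a1 + n.+1%:R) / k.+1%:R)%R ->
  radon_estimate n.+1 k.+1 a1 a2 p gamma ->
  (gamma <= (a1 + a2 + n.+1%:R - 1) / p)%R.
Proof.
move=> kn p0 pE /(radon_estimate_shells kn p0 pE)[C [C0 H]].
rewrite leNgt; apply/negP => gg; set g := (_ / p)%R in H gg.
have d0 : (0 < (gamma - g) / 2)%R by lra.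
have [X [X4 CX]] := powR_unbounded C d0.
have X0 : (0 < X)%R by lra.
have := H X 1%R X4; rewrite ltr01 lexx !powR1 !mulr1 => /(_ isT).
rewrite leNgt => /negP; apply.
have -> : (gamma / 2 = (gamma - g) / 2 + g / 2)%R by field.
by rewrite powRD ?(gt_eqF X0) ?implybT// ltr_pM2r ?powR_gt0.
Qed.

Lemma radon_estimate_line n (a1 a2 p gamma : R) : (1 < n.+1)%N ->
  (0 < p)%R -> p = (a1 + n.+1%:R)%R ->
  radon_estimate n.+1 1 a1 a2 p gamma -> (2 <= p)%R.
Proof.
move=> n1 p0 pE est; have pE' : p = ((a1 + n.+1%:R) / 1%:R)%R by rewrite divr1.
have [C [C0 H]] := radon_estimate_shells n1 p0 pE' est.
rewrite leNgt; apply/negP => p2.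
have d0 : (0 < p^-1 - 2^-1)%R by rewrite subr_gt0 ltf_pV2 ?posrE.
set g := ((_ - 1) / p / 2)%R in H.
(* With [r = 1 / Y] and [X] frozen at 4, the shell inequality bounds [Y^(1/p - 1/2)], which is
   unbounded if [p < 2]. *)
have [Y [Y4 CY]] := powR_unbounded (C * 4 `^ g / 4 `^ (gamma / 2))%R d0.
have Y0 : (0 < Y)%R by lra.
have := H 4%R Y^-1%R (lexx _); rewrite invr_gt0 Y0 invf_le1// (_ : (1 <= Y)%R); last by lra.
move=> /(_ isT); rewrite leNgt => /negP; apply.
have Yp s : (Y^-1 `^ s = (Y `^ s)^-1)%R.
  by rewrite -(powR_inv1 (ltW Y0)) -powRrM mulrC powRrM powR_inv1 ?powR_ge0.
have b0 : (0 < 4 `^ (gamma / 2) :> R)%R by rewrite powR_gt0.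
have u0 : (0 < Y `^ p^-1)%R by rewrite powR_gt0.
have v0 : (0 < Y `^ (1%:R / 2))%R by rewrite powR_gt0.
have uE : (Y `^ p^-1 = Y `^ (p^-1 - 2^-1) * Y `^ (1%:R / 2))%R.
  rewrite -powRD ?(gt_eqF Y0) ?implybT//; congr (_ `^ _)%R; field.
  by rewrite gt_eqF.
move: CY; rewrite ltr_pdivrMr// => CY.
rewrite !Yp mulrA.
have -> : (4 `^ (gamma / 2) * (Y `^ (1%:R / 2))^-1 =
    Y `^ (p^-1 - 2^-1) * 4 `^ (gamma / 2) * (Y `^ p^-1)^-1)%R.
  apply: (mulIf (lt0r_neq0 u0)); rewrite divfK ?gt_eqF// {1}uE.
  by field; rewrite gt_eqF.
by rewrite ltr_pM2r// invr_gt0.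
Qed.

End necessity.

Theorem theorem5p5 (R : realType) (n k : nat) (a1 a2 p gamma : R) :
  (2 <= n)%N -> (1 <= k <= n - 1)%N ->
  ((k%:R - n%:R < a1 + a2 /\ 1 <= p /\ p = (a1 + n%:R) / k%:R /\
      (k = 1%N \/ p < (a1 + a2 + n%:R - 1) / (k%:R - 1)))
   \/ (a1 + a2 = k%:R - n%:R /\ (a1 + n%:R) / k%:R = 1 /\ p = 1)) ->
  ((2 <= k)%N ->
     (radon_estimate n k a1 a2 p gamma <-> gamma <= (a1 + a2 + n%:R - 1) / p)) /\
  (k = 1%N ->
     (radon_estimate n k a1 a2 p gamma <->
        gamma <= (a1 + a2 + n%:R - 1) / p /\ 2 <= p)).
Proof.
case: n => // n n1; case: k => // k kn hyp.
have {kn} kn : (k.+1 < n.+1)%N by move: kn; rewrite subn1 ltnS.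
have k0 : (0 : R) < k.+1%:R by rewrite ltr0n.
have pE : p = (a1 + n.+1%:R) / k.+1%:R.
  by case: hyp => [[_ [_ [->]]]|[_ [-> ->]]].
have a1E : a1 = p * k.+1%:R - n.+1%:R.
  by rewrite pE divfK ?addrK// gt_eqF.
have p1 : 1 <= p by case: hyp => [[_ []]|[_ [_ ->]]].
have p0 : 0 < p by lra.
(* Substituting [a1 = p k - n] leaves a condition on [a2] alone. At [p = 1] the first alternative
   gives [a2 > 0] and the second [a2 = 0]. *)
have pa : p = 1 /\ 0 <= a2 \/ 1 < p /\ 1 - p < a2.
  case: hyp => [[h1 [_ [_ h2]]]|[h1 [_ h2]]]; last first.
    by left; split=> //; move: h1; rewrite a1E h2; lra.
  have h3 : 1 - p < a2.
    case: h2 => [[k00]|].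
      by move: h1; rewrite a1E k00 mulr1; lra.
    (* For lines the denominator [k - 1] vanishes, and [1 - p < a2] is drawn from [k - n < a1 + a2]
       instead. *)
    case: k k0 pE a1E h1 kn => [|k] k0 pE a1E h1 kn.
      by move: h1; rewrite a1E mulr1; lra.
    rewrite ltr_pdivlMr; last by rewrite subr_gt0 ltr1n.
    by rewrite a1E; lra.
  by move: p1; rewrite le_eqVlt => /predU1P[p1|p1]; [left; split=> //; lra|right].
split=> [k2|[k00]].
  split; first exact: radon_estimate_gamma.
  apply: radon_estimate_sufficient => //.
  (* Here [1 <= p k / 2] follows from [p >= 1] and [k >= 2]; for [k = 1] it is the extra condition
     [p >= 2]. *)
  have k2' : (2 : R) <= k.+1%:R by rewrite ler_nat.
  by rewrite mulrA ler_pdivlMr// mul1r; nra.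
move: kn pE; rewrite {}k00 => kn pE; split.
  move=> est; split; first exact: radon_estimate_gamma est.
  by apply: radon_estimate_line est => //; rewrite pE divr1.
move=> [gg p2]; apply: radon_estimate_sufficient => //.
by rewrite mulrA mulr1 ler_pdivlMr// mul1r.
Qed.
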